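(* Let $r,n\ge2$ be two integers, $\mathtt s=(s_1,\dots,s_{n-1})\in\mathbb N^{n-1}$ with $1\le s_i\le r-1$ for all $i=1,\dots,n-1$, and let $I_0\in\mathbb R^n$. For $m=1$, let $\mathcal Z_n^{r,s_1,1}$ be the algebraic set of pairs $(Q,w)$ determined by $$Q\in\mathcal P^\star(r,n),\quad w\in\mathbb R^n,\ \|w\|_2=1,\quad Q^1_{I_0}[w]=Q^2_{I_0}[w,w]=\dots=Q^{s_1+1}_{I_0}[w,\dots,w]=0 .$$ For $n\ge3$ and $m\in\{2,\dots,n-1\}$, let $\mathcal Z_n^{r,s_m,m}$ be the algebraic set of $\mathcal P^\star(r,n)\times\mathbb R^{(m-1)s_m}\times\mathscr V^1(m,n)$ of elements $(Q,a(m,s_m),(v,u_2,\dots,u_m))$ determined by $$\begin{cases}(u_1,\dots,u_m)\in\mathtt U(m,n),\quad Q\in\mathcal P^\star(r,n)\\ a(m,s_m):=(a_{21},\dots,a_{2s_m},\dots,a_{m1},\dots,a_{ms_m})\in\mathbb R^{(m-1)\times s_m}\\ v=u_1+\sum_{j=2}^m a_{j1}u_j\\ Q^1_{I_0}[v]=Q^1_{I_0}[u_2]=\dots=Q^1_{I_0}[u_m]=0\\ \sum_{\ell=1}^m\sum_{\alpha=1}^{s_m}\big|\mathcal H^{Q,I_0}_{m,\ell,\alpha}(v,u_2,\dots,u_m,a(m,s_m))\big|=0.\end{cases}$$ Then $$\bigcup_{m=1}^{n-1}\operatorname{closure}\Big(\Pi_{\mathcal P^\star(r,n)}\,\mathcal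 Z_n^{r,s_m,m}\Big)=\boldsymbol\Omega_n^{r,\mathtt s},$$ where $\Pi_{\mathcal P^\star(r,n)}$ denotes the projection onto the first factor, the closure is taken in $\mathcal P^\star(r,n)$, and $\boldsymbol\Omega_n^{r,\mathtt s}$ is the semi-algebraic ''bad set'' defined in the context.
   Context: $\mathcal P(r,n)$: real polynomials in $n$ variables with zero constant term and degree at most $r$ (topology of $\mathbb R^{\dim\mathcal P(r,n)}$); $\mathcal P^\star(r,n)$: those with non-zero gradient at the origin. Polynomials $Q$ are here regarded as functions of $I-I_0$, so that $Q^k_{I_0}$ is the $k$-th differential of $Q$ at $I=I_0$. $\mathtt U(k,n)$: Stiefel manifold of ordered orthonormal $k$-tuples in $\mathbb R^n$. $\mathscr V^1(m,n):=\{(v,u_2,\dots,u_m)\in\mathbb R^n\times\mathtt U(m-1,n):\operatorname{rank}(v,u_2,\dots,u_m)=m\}$. The bad set. Let $\Theta_m$ be the set of curves $\gamma$ with values in $\mathbb R^m$, real-analytic near $t=0$, $\gamma(0)=0$, such that for some $i$ one has $x_i(t)=t$ and $x_j(t)=f_j(t)$ for $j\ne i$. The $s$-truncation $\mathcal J_{s,\gamma}$ is the componentwise Taylor polynomial of order $s$ of $\gamma$ at $0$. $P\in\mathcal P(r,m)$ is $s$-vanishing if for some $\gamma\in\Theta_m$ one has $\frac{d^\alpha}{dt^\alpha}\big(\frac{\partial P}{\partial x_\ell}(\mathcal J_{s,\gamma}(t))\big)_{t=0}=0$ for all $\ell\in\{1,\dots,m\}$, $\alpha\in\{0,\dots,s\}$.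 $\sigma(r,s,m)\subset\mathcal P(r,m)$ is the set of $s$-vanishing polynomials and $\Sigma(r,s,m)$ its closure. $\mathcal V(r,s,m,n)$ is the set of $Q\in\mathcal P^\star(r,n)$ such that, for some real $n\times m$ matrix $A$ with orthonormal columns, the polynomial $x\mapsto Q(Ax)$ belongs to $\Sigma(r,s,m)$ (here the argument of $Q$ is the increment from the base point). Finally $\boldsymbol\Omega_n^{r,\mathtt s}:=\bigcup_{m=1}^{n-1}\mathcal V(r,s_m,m,n)$. (This is the set of the paper's theorem on genericity of steepness: sufficiently regular functions with non-zero gradient at $I_0$ whose $r$-jet at $I_0$ is at positive distance from it are steep near $I_0$.) Definition of $\mathcal H$. $\mathbb N=\{0,1,\dots\}$. $h^k_{I_0}[w_1,\dots,w_k]:=D^kh(I_0)(w_1,\dots,w_k)$; $w^{\{k\}}$ means that the entry $w$ is repeated $k$ times. Let $m\ge2$. For $\alpha\ge1$ and $\beta\in\{0,\dots,\alpha\}$ set $\nu(1,\beta)=(\beta+1,0,\dots,0)\in\mathbb N^m$ and, for $i=2,\dots,m$, $\nu(i,\beta)=(\beta,0,\dots,0,1,0,\dots,0)$ with the $1$ in slot $i$. Let $\mathcal M_m(\alpha):=\{\mu\in\mathbb N^m:2\le|\mu|\le\alpha+1\}\setminus\{\nu(i,\beta):1\le i\le m,1\le\beta\le\alpha\}$, $|\mu|=\mu_1+\dots+\mu_m$. For $\ell\in\{1,\dots,m\}$, $\widetilde\mu_i(\ell):=\mu_i-\delta_{i\ell}$. Let $\mathcal G_m(\widetilde\mu(\ell),\alpha)$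 be the set of $k=(k_{ji})_{2\le j\le m,\,2\le i\le\alpha}\in\mathbb N^{(m-1)(\alpha-1)}$ such that $\sum_{i=2}^\alpha k_{ji}=\widetilde\mu_j(\ell)$ for $j=2,\dots,m$ and $\widetilde\mu_1(\ell)+\sum_{j=2}^m\sum_{i=2}^\alpha i\,k_{ji}=\alpha$; let $\mathcal E_m(\ell,\alpha):=\{\mu\in\mathbb N^m:\mathcal G_m(\widetilde\mu(\ell),\alpha)\ne\varnothing\}$ and $k!:=\prod_{j,i}k_{ji}!$. For $h$ of class $C^r$ near $I_0$, $1\le s\le r-1$, $a=(a_{ji})_{2\le j\le m,1\le i\le s}$, $(v,u_2,\dots,u_m)\in\mathscr V^1(m,n)$, write $[\,a u\,]_k$ for the list of entries $(a_{22}u_2)^{\{k_{22}\}},\dots,(a_{2\alpha}u_2)^{\{k_{2\alpha}\}},\dots,(a_{m2}u_m)^{\{k_{m2}\}},\dots,(a_{m\alpha}u_m)^{\{k_{m\alpha}\}}$. Then $\mathcal H^{h,I_0}_{m,\ell,\alpha}(v,u_2,\dots,u_m,a)$ is: - $\mathcal H_{m,1,1}=h^2_{I_0}[v,v]$; $\mathcal H_{m,\ell,1}=h^2_{I_0}[v,u_\ell]$ for $\ell=2,\dots,m$; $\mathcal H_{m,1,2}=h^3_{I_0}[v,v,v]$ (if $s\ge2$); - for $\ell=1$, $3\le\alpha\le s$: $$\mathcal H_{m,1,\alpha}=\tfrac1{\alpha!}h^{\alpha+1}_{I_0}[v^{\{\alpha+1\}}]+\sum_{\beta=1}^{\alpha-1}\tfrac1{(\beta-1)!}h^{\beta+1}_{I_0}\Big[v^{\{\beta\}},\sum_{i=2}^m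 a_{i(\alpha-(\beta-1))}u_i\Big]+\sum_{\substack{\mu\in\mathcal E_m(1,\alpha)\cap\mathcal M_m(\alpha)\\ \mu_1\ne0}}\ \sum_{k\in\mathcal G_m(\widetilde\mu(1),\alpha)}\frac{h^{|\mu|}_{I_0}\big[v^{\{\mu_1-1\}},[au]_k,v\big]}{(\mu_1-1)!\,k!};$$ - for $2\le\ell\le m$, $2\le\alpha\le s$: $$\mathcal H_{m,\ell,\alpha}=\tfrac1{\alpha!}h^{\alpha+1}_{I_0}[v^{\{\alpha\}},u_\ell]+\sum_{\substack{\mu\in\mathcal E_m(\ell,\alpha)\cap\mathcal M_m(\alpha)\\ \mu_\ell\ne0}}\ \sum_{k\in\mathcal G_m(\widetilde\mu(\ell),\alpha)}\frac{h^{|\mu|}_{I_0}\big[v^{\{\mu_1\}},[au]_k,u_\ell\big]}{\mu_1!\,k!}.$$ $\mathcal H^{Q,I_0}_{m,\ell,\alpha}$ is the same expression with $h$ replaced by $Q$. *)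

(* Defs.v *)
From HB Require Import structures.
From mathcomp Require Import all_boot all_order all_algebra.
From mathcomp Require Import all_classical all_reals all_analysis.
(* The notations of multinomials clash with those of mathcomp-analysis, hence
   the applicative forms mcoeff, meval, mderiv, comp_mpoly below. *)
From mathcomp Require mpoly.
Export -(notations) mpoly.
Export numFieldNormedType.Exports.

Set Implicit Arguments.
Unset Strict Implicit.
Unset Printing Implicit Defensive.

Import Order.TTheory GRing.Theory Num.Theory.

Local Open Scope classical_set_scope.
Local Open Scope ring_scope.

(* Polynomials of degree at most r without constant term, and their topology. *)

Section Polynomials.
Variable R : realType.

(* msize is the degree plus one (0 for the zero polynomial). *)
Definition Pol (r n : nat) : set (mpoly n R) :=
  [set P | mcoeff mnm0 P = 0 /\ (mmeasure mdeg P <= r.+1)%N].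

Definition Polstar (r n : nat) : set (mpoly n R) :=
  [set P | Pol r P /\ exists i : 'I_n, meval (fun=> 0) (mderiv i P) != 0].

Definition monomials (r n : nat) : {set bmultinom n r.+1} :=
  [set b : bmultinom n r.+1 | (0 < mdeg b)%N]%SET.

Definition coefv (r n : nat) (P : mpoly n R) : 'rV[R]_#|monomials r n| :=
  \row_i mcoeff (enum_val i : bmultinom n r.+1) P.

(* coefv r identifies Pol r n with R^(dim Pol r n).  For S included in a subset
   D of Pol r n, this is the closure of S in the subspace D. *)
Definition closure_in (r n : nat) (D S : set (mpoly n R)) : set (mpoly n R) :=
  [set P | D P /\ closure (@coefv r n @` S) (coefv r P)].

(* The polynomial x |-> Q (A x). *)
Definition pol_comp_mx (m n : nat) (Q : mpoly n R) (A : 'M[R]_(n, m)) :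
    mpoly m R :=
  comp_mpoly [tuple \sum_(j < m) A i j *: (mpolyX R (mnm1 j)) | i < n] Q.

End Polynomials.

Section BadSet.
Variable R : realType.

Definition analytic_at (f : R -> R) (x : R) : Prop :=
  exists c : R^nat, \forall y \near x, pseries c (y - x) @ \oo --> f y.

Definition Theta (m : nat) : set ('I_m -> R -> R) :=
  [set g | [/\ forall j, \forall t \near (0 : R), analytic_at (g j) t,
               forall j, g j 0 = 0
             & exists i, \forall t \near (0 : R), g i t = t]].

Definition truncation (s m : nat) (g : 'I_m -> R -> R) (t : R) : 'I_m -> R :=
  fun j => \sum_(k < s.+1) ((g j)^`(k)%classic 0 / k`!%:R) * t ^+ k.

Definition s_vanishing (s m : nat) (P : mpoly m R) : Prop :=
  exists2 g, Theta g &
    forall (l : 'I_m) (alpha : nat), (alpha <= s)%N ->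
      (fun t : R => meval (truncation s g t) (mderiv l P))^`(alpha)%classic 0
        = 0.

Definition sigma (r s m : nat) : set (mpoly m R) :=
  [set P | Pol r P /\ s_vanishing s P].

Definition Sigma (r s m : nat) : set (mpoly m R) :=
  closure_in r (@Pol R r m) (@sigma r s m).

Definition badV (r s m n : nat) : set (mpoly n R) :=
  [set Q | Polstar r Q /\ exists A : 'M[R]_(n, m),
     A^T *m A = 1%:M /\ Sigma r s (pol_comp_mx Q A)].

(* s_m is s i with m = i.+1. *)
Definition Omega (r n : nat) (s : 'I_n.-1 -> nat) : set (mpoly n R) :=
  \bigcup_(i in [set: 'I_n.-1]) @badV r (s i) i.+1 n.

End BadSet.

Section Differentials.
Variables (R : realType) (n : nat).
Implicit Types (h : 'rV[R]_n -> R) (Q : mpoly n R) (x w : 'rV[R]_n).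

(* hdiff h ws x = D^k h (x) (w_1, .., w_k) for ws = [:: w_1; ..; w_k]. *)
Fixpoint hdiff h (ws : seq 'rV[R]_n) : 'rV[R]_n -> R :=
  if ws is w :: ws' then fun x => 'd (hdiff h ws') x w else h.

(* Q is a function of the increment I - I_0. *)
Definition pol_fun Q (I0 : 'rV[R]_n) : 'rV[R]_n -> R :=
  fun x => meval ((x - I0) 0) Q.

Definition norm2 w : R := Num.sqrt (\sum_i w 0 i ^+ 2).

(* Ordered tuples of vectors are the rows of a matrix. *)
Definition Stiefel (k : nat) : set 'M[R]_(k, n) :=
  [set U | U *m U^T = 1%:M].

(* m = p.+1; the rows of u are u_2, .., u_m. *)
Definition V1 (p : nat) : set ('rV[R]_n * 'M[R]_(p, n)) :=
  [set vu | Stiefel vu.2 /\ \rank (col_mx vu.1 vu.2) = p.+1].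

End Differentials.

(* From here on m = p.+1 >= 2.  The indices l in {1, .., m} are the elements of
   'I_p.+1 shifted by one; the indices j in {2, .., m} are the elements of 'I_p
   shifted by two, j corresponding to lift ord0 j among the former.  The
   indices i in {2, .., alpha} are the elements of 'I_alpha.-1 shifted by two.
   The exponents alpha, beta are never shifted. *)

Section MultiIndices.
Variable p : nat.
Notation multiidx := {ffun 'I_p.+1 -> nat}.

(* beta * e_1 + e_i, which for i = 1 is (beta + 1) * e_1. *)
Definition nu (i : 'I_p.+1) (beta : nat) : multiidx :=
  [ffun x => (beta * (x == ord0) + (x == i))%N].

Definition mlen (mu : multiidx) : nat := (\sum_i mu i)%N.

Definition Mset (alpha : nat) : set multiidx :=
  [set mu | (2 <= mlen mu <= alpha.+1)%N] `\`
  [set mu | exists i beta, (1 <= beta <= alpha)%N /\ mu = nu i beta].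

(* An integer: it is -1 at l when mu l = 0. *)
Definition mu_tilde (l : 'I_p.+1) (mu : multiidx) : 'I_p.+1 -> int :=
  fun i => (mu i)%:Z - (i == l)%:Z.

Definition Gset (mt : 'I_p.+1 -> int) (alpha : nat) :
    set 'M[nat]_(p, alpha.-1) :=
  [set k : 'M[nat]_(p, alpha.-1) | (forall j : 'I_p, (\sum_i k j i)%N%:Z = mt (lift ord0 j)) /\
     mt ord0 + (\sum_j \sum_(i < alpha.-1) i.+2 * k j i)%N%:Z = alpha%:Z].

Definition Eset (l : 'I_p.+1) (alpha : nat) : set multiidx :=
  [set mu | @Gset (mu_tilde l mu) alpha !=set0].

Definition kfact (alpha : nat) (k : 'M[nat]_(p, alpha.-1)) : nat :=
  (\prod_j \prod_i (k j i)`!)%N.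

End MultiIndices.

Arguments Gset {p} mt alpha.

Section H.
Variables (R : realType) (n p s : nat).
Variables (h : 'rV[R]_n -> R) (I0 : 'rV[R]_n).
Variables (v : 'rV[R]_n) (u : 'M[R]_(p, n)) (a : 'M[R]_(p, s)).

(* a_{ji} with i in {1, .., s} not shifted; only such i occur below. *)
Definition acoef (j : 'I_p) (i : nat) : R := oapp (a j) 0 (insub i.-1).

Definition au (alpha : nat) (k : 'M[nat]_(p, alpha.-1)) : seq 'rV[R]_n :=
  flatten [seq nseq (k j i) (acoef j i.+2 *: row j u)
          | j <- enum 'I_p, i <- enum 'I_alpha.-1].

Definition H1 (alpha : nat) : R :=
  match alpha with
  | 1 => hdiff h [:: v; v] I0
  | 2 => hdiff h [:: v; v; v] I0
  | _ =>
    (alpha`!%:R)^-1 * hdiff h (nseq alpha.+1 v) I0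
    + \sum_(1 <= beta < alpha) ((beta - 1)`!%:R)^-1 *
        hdiff h (nseq beta v ++
          [:: \sum_(i < p) acoef i (alpha - (beta - 1))%N *: row i u]) I0
    + \sum_(mu \in Eset ord0 alpha `&` Mset alpha
                   `&` [set mu : {ffun 'I_p.+1 -> nat} | mu ord0 != 0%N])
        \sum_(k \in Gset (mu_tilde ord0 mu) alpha)
          hdiff h (nseq (mu ord0 - 1)%N v ++ au k ++ [:: v]) I0
            / ((mu ord0 - 1)`! * kfact k)%N%:R
  end.

Definition Hj (j : 'I_p) (alpha : nat) : R :=
  match alpha with
  | 1 => hdiff h [:: v; row j u] I0
  | _ =>
    (alpha`!%:R)^-1 * hdiff h (nseq alpha v ++ [:: row j u]) I0
    + \sum_(mu \in Eset (lift ord0 j) alpha `&` Mset alpha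
           `&` [set mu : {ffun 'I_p.+1 -> nat} | mu (lift ord0 j) != 0%N])
        \sum_(k \in Gset (mu_tilde (lift ord0 j) mu) alpha)
          hdiff h (nseq (mu ord0) v ++ au k ++ [:: row j u]) I0
            / ((mu ord0)`! * kfact k)%N%:R
  end.

Definition calH (l : 'I_p.+1) (alpha : nat) : R :=
  if unlift ord0 l is Some j then Hj j alpha else H1 alpha.

End H.

Section Zsets.
Variables (R : realType) (r n : nat) (I0 : 'rV[R]_n).

Definition Z1 (s : nat) : set (mpoly n R * 'rV[R]_n) :=
  [set Qw | [/\ Polstar r Qw.1, norm2 Qw.2 = 1
    & forall k, (1 <= k <= s.+1)%N ->
        hdiff (pol_fun Qw.1 I0) (nseq k Qw.2) I0 = 0]].

Definition Zm (p s : nat) :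
    set (mpoly n R * 'M[R]_(p, s) * ('rV[R]_n * 'M[R]_(p, n))) :=
  [set z | let: (Q, a, (v, u)) := z in
    [/\ Polstar r Q, V1 (v, u),
        exists u1 : 'rV[R]_n, Stiefel (col_mx u1 u) /\
          v = u1 + \sum_(j < p) acoef a j 1 *: row j u,
        hdiff (pol_fun Q I0) [:: v] I0 = 0 /\
          forall j : 'I_p, hdiff (pol_fun Q I0) [:: row j u] I0 = 0
      & \sum_(l < p.+1) \sum_(1 <= alpha < s.+1)
          `|calH (pol_fun Q I0) I0 v u a l alpha| = 0]].

(* The projection of Z for m = p.+1 onto its first factor. *)
Definition projZ (p s : nat) : set (mpoly n R) :=
  if p is 0 then fst @` Z1 s else (fun z => z.1.1) @` @Zm p s.

End Zsets.

(* Main.v *)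
Require Import Defs.
From HB Require Import structures.
From mathcomp Require Import all_boot all_order all_algebra.
From mathcomp Require Import all_classical all_reals all_analysis.

(** A polynomial [P = Q o A] in [m] variables is [s]-vanishing when the
    derivatives of [Q] in the directions of the columns of [A] vanish up to
    order [s] along a curve [A (J t)], where [J] is the [s]-jet of a curve one
    of whose coordinates is [t]. If [u_1, .., u_m] are the columns of [A],
    numbered so that this coordinate is the first one, and if the [a_ji] are
    the Taylor coefficients of the others, then
      [A (J t) = t v + sum_(j >= 2) sum_(2 <= i <= s) t^i a_ji u_j],
      [v = u_1 + sum_(j >= 2) a_j1 u_j].
    The vectors [v, u_2, .., u_m] and [u_1, .., u_m] span the same space, so
    that [s]-vanishing means that the coefficients of [t^alpha], [alpha <= s],
    of [D Q (A (J t)) [e]] are zero for [e = v, u_2, .., u_m].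

    By Taylor's formula such a coefficient is a sum over the exponents of [v]
    and of the [a_ji u_j] whose total weight is [alpha], the weight of [a_ji
    u_j] being [i]: this is [coef_cpoly_curve]. Sorting these exponents by
    their sums over [i], which form the multi-index [mu], gives the sums that
    define [H] ([sum_mu_k]). The multi-indices [nu] which are removed from that
    sum are those of the monomials with no factor [u_j] besides [e] itself, and
    for [e = v] also those with exactly one such factor; they are the terms
    that the definition of [H] writes separately ([Hj_Taylor], [H1_Taylor]).
    Hence [H] is the Taylor coefficient, except for [m,1,2], where the two
    agree up to a factor once the coefficients of order [1] vanish
    ([H1_Taylor2]).

    It follows that the projection of the algebraic set is the set of those [Q]
    with non-zero gradient for which [Q o A] is [s]-vanishing for some
    orthonormal [A] ([projZE]). Taking closures commutes with the existence of
    [A]. On the one hand orthonormal frames form a compact set and [Q o A]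
    depends continuously on [Q] and [A] ([closure_projZ_sub]). On the other
    hand, if [Q o A] is a limit of [s]-vanishing [P], then [Q] is the limit of
    the polynomials [Q + (P - Q o A) o A^T], whose composites with [A] are the
    [P] because [A^T A = 1] ([badV_sub_closure_projZ]). *)

Set Implicit Arguments.
Unset Strict Implicit.
Unset Printing Implicit Defensive.

Import Order.TTheory GRing.Theory Num.Theory.

Local Open Scope classical_set_scope.
Local Open Scope ring_scope.

Local Notation "[ 'multinom' E | i < n ]" :=
  (Multinom [tuple E%N | i < n]) (at level 0, i at level 0).

(** * Directional derivatives and linear substitutions *)

Section PolynomialInduction.
Variables (R : comNzRingType) (n : nat).

(** Constants and variables generate the ring of polynomials; this settles the
    identities between ring morphisms and derivations below. *)
Lemma mpoly_ring_ind (P : mpoly n R -> Prop) :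
  (forall c, P (mpolyC n c)) -> (forall i, P (mpolyX R (mnm1 i))) ->
  (forall p q, P p -> P q -> P (p + q)) ->
  (forall p q, P p -> P q -> P (p * q)) -> forall p, P p.
Proof.
move=> PC PX PD PM; elim/mpolyind => [|c m p _ _ Pp].
  by rewrite -(mpolyC0 n R); exact: PC.
apply: (PD) => //; rewrite -mul_mpolyC mpolyXE_id; apply: (PM) => //.
have P1 : P 1 by rewrite -(mpolyC1 n R); exact: PC.
apply: big_ind => // i _; elim: (m i) => [|k IH]; first by rewrite expr0.
by rewrite exprS; exact: PM.
Qed.

Lemma meval0E (G : mpoly n R) : meval (fun=> 0) G = mcoeff mnm0 G.
Proof.
elim/mpoly_ring_ind: G => [c|i|p q IHp IHq|p q IHp IHq].
- by rewrite mevalC mcoeffC eqxx mulr1.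
- by rewrite mevalXU mcoeffX mnm1_eq0.
- by rewrite mevalD mcoeffD IHp IHq.
- by rewrite mevalM rmorphM IHp IHq.
Qed.

End PolynomialInduction.

Section DirectionalDerivatives.
Variables (R : comNzRingType) (n : nat).
Implicit Types (G Q : mpoly n R) (w : 'rV[R]_n).

Definition dder w G : mpoly n R := \sum_i w 0 i *: mderiv i G.

(** The outermost derivative is the head of the list, as in [hdiff]. *)
Definition ddern (ws : seq 'rV[R]_n) G : mpoly n R := foldr dder G ws.

Lemma ddern_cat ws ws' G : ddern (ws ++ ws') G = ddern ws (ddern ws' G).
Proof. exact: foldr_cat. Qed.

Lemma dder_linear w : linear (dder w).
Proof.
move=> c p q; rewrite /dder scaler_sumr -big_split /=; apply: eq_bigr => i _.
by rewrite mderivD mderivZ scalerDr !scalerA mulrC.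
Qed.

HB.instance Definition _ w :=
  GRing.isLinear.Build R (mpoly n R) (mpoly n R) _ (dder w) (dder_linear w).

Lemma dderD w p q : dder w (p + q) = dder w p + dder w q.
Proof. exact: linearD. Qed.

Lemma dderM w p q : dder w (p * q) = dder w p * q + p * dder w q.
Proof.
rewrite /dder mulr_suml mulr_sumr -big_split /=; apply: eq_bigr => i _.
by rewrite mderivM scalerDr scalerAl scalerAr.
Qed.

Lemma dderC w c : dder w (mpolyC n c) = 0.
Proof. by rewrite /dder big1 // => i _; rewrite mderivC scaler0. Qed.

Lemma dderX w i : dder w (mpolyX R (mnm1 i)) = mpolyC n (w 0 i).
Proof.
rewrite /dder (bigD1 i) //= big1 => [|j ji]; last first.
  by rewrite mderivX mnm1E eq_sym (negbTE ji) scale0r scaler0.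
have U0 : mnm_sub (mnm1 i) (mnm1 i) = mnm0.
  by apply/mnmP => k; rewrite mnmBE subnn mnm0E.
by rewrite addr0 mderivX mnm1E eqxx scale1r U0 mpolyX0 alg_mpolyC.
Qed.

Lemma dderlD w w' G : dder (w + w') G = dder w G + dder w' G.
Proof.
rewrite /dder -big_split; apply: eq_bigr => i _.
by rewrite mxE scalerDl.
Qed.

Lemma dderlZ c w G : dder (c *: w) G = c *: dder w G.
Proof.
by rewrite /dder scaler_sumr; apply: eq_bigr => i _; rewrite mxE scalerA.
Qed.

Lemma dderl0 G : dder 0 G = 0.
Proof. by rewrite /dder big1 // => i _; rewrite mxE scale0r. Qed.

Lemma dderl_sum (I : Type) (r : seq I) (P : pred I) (F : I -> 'rV[R]_n) G :
  dder (\sum_(i <- r | P i) F i) G = \sum_(i <- r | P i) dder (F i) G.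
Proof.
exact: (big_morph (dder^~ G) (fun w w' => dderlD w w' G) (dderl0 G)).
Qed.

Lemma dder_comm w w' G : dder w (dder w' G) = dder w' (dder w G).
Proof.
have E a b : dder a (dder b G) =
    \sum_i \sum_j (a 0 i * b 0 j) *: mderiv i (mderiv j G).
  apply: eq_bigr => i _; rewrite {1}/dder [mderiv i _]raddf_sum scaler_sumr.
  apply: eq_bigr => j _.
  by rewrite /= mderivZ scalerA.
rewrite !E exchange_big; apply: eq_bigr => i _; apply: eq_bigr => j _.
by rewrite mulrC mderiv_comm.
Qed.

Lemma ddern_sum ws (I : Type) (r : seq I) (P : pred I) (F : I -> mpoly n R) :
  ddern ws (\sum_(i <- r | P i) F i) = \sum_(i <- r | P i) ddern ws (F i).
Proof. by elim: ws => //= w ws ->; rewrite raddf_sum. Qed.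

End DirectionalDerivatives.

Section LinearSubstitution.
Variable R : realType.

Lemma pol_comp_mxC m n (A : 'M[R]_(n, m)) c :
  pol_comp_mx (mpolyC n c) A = mpolyC m c.
Proof. exact: comp_mpolyC. Qed.

Lemma pol_comp_mxX m n (A : 'M[R]_(n, m)) i :
  pol_comp_mx (mpolyX R (mnm1 i)) A = \sum_j A i j *: mpolyX R (mnm1 j).
Proof. by rewrite /pol_comp_mx comp_mpolyXU -tnth_nth tnth_mktuple. Qed.

Lemma pol_comp_mxM m n (A : 'M[R]_(n, m)) (p q : mpoly n R) :
  pol_comp_mx (p * q) A = pol_comp_mx p A * pol_comp_mx q A.
Proof. exact: rmorphM. Qed.

Lemma pol_comp_mx0 m n (A : 'M[R]_(n, m)) : pol_comp_mx 0 A = 0.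
Proof. exact: comp_mpoly0. Qed.

Lemma pol_comp_mxD m n (A : 'M[R]_(n, m)) (p q : mpoly n R) :
  pol_comp_mx (p + q) A = pol_comp_mx p A + pol_comp_mx q A.
Proof. exact: comp_mpolyD. Qed.

Lemma pol_comp_mxB m n (A : 'M[R]_(n, m)) (p q : mpoly n R) :
  pol_comp_mx (p - q) A = pol_comp_mx p A - pol_comp_mx q A.
Proof. exact: comp_mpolyB. Qed.

Lemma pol_comp_mxZ m n (A : 'M[R]_(n, m)) c (p : mpoly n R) :
  pol_comp_mx (c *: p) A = c *: pol_comp_mx p A.
Proof. exact: comp_mpolyZ. Qed.

Lemma pol_comp_mx_sum m n (A : 'M[R]_(n, m)) (I : Type) (r : seq I)
    (P : pred I) (F : I -> mpoly n R) :
  pol_comp_mx (\sum_(i <- r | P i) F i) A =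
  \sum_(i <- r | P i) pol_comp_mx (F i) A.
Proof. by rewrite /pol_comp_mx raddf_sum. Qed.

Lemma pol_comp_mx1 n (Q : mpoly n R) : pol_comp_mx Q 1%:M = Q.
Proof.
elim/mpoly_ring_ind: Q => [c|i|p q IHp IHq|p q IHp IHq].
- by rewrite pol_comp_mxC.
- rewrite pol_comp_mxX (bigD1 i) //= mxE eqxx scale1r big1 ?addr0 // => j ji.
  by rewrite mxE eq_sym (negbTE ji) scale0r.
- by rewrite pol_comp_mxD IHp IHq.
- by rewrite pol_comp_mxM IHp IHq.
Qed.

Lemma pol_comp_mx_mul k m n (A : 'M[R]_(n, m)) (B : 'M[R]_(m, k))
    (Q : mpoly n R) :
  pol_comp_mx (pol_comp_mx Q A) B = pol_comp_mx Q (A *m B).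
Proof.
elim/mpoly_ring_ind: Q => [c|i|p q IHp IHq|p q IHp IHq].
- by rewrite !pol_comp_mxC.
- rewrite !pol_comp_mxX pol_comp_mx_sum.
  transitivity (\sum_j \sum_l A i j * B j l *: mpolyX R (mnm1 l)).
    apply: eq_bigr => j _; rewrite pol_comp_mxZ pol_comp_mxX scaler_sumr.
    by apply: eq_bigr => l _; rewrite scalerA.
  by rewrite exchange_big; apply: eq_bigr => l _; rewrite mxE scaler_suml.
- by rewrite !pol_comp_mxD IHp IHq.
- by rewrite !pol_comp_mxM IHp IHq.
Qed.

Lemma meval_pol_comp_mx m n (A : 'M[R]_(n, m)) (Q : mpoly n R) x :
  meval x (pol_comp_mx Q A) = meval (fun i => \sum_j A i j * x j) Q.
Proof.
rewrite /pol_comp_mx comp_mpoly_meval; apply: meval_eq => i.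
rewrite tnth_mktuple raddf_sum; apply: eq_bigr => j _.
by rewrite /= mevalZ mevalXU.
Qed.

Lemma mderiv_pol_comp_mx m n (A : 'M[R]_(n, m)) (Q : mpoly n R) j :
  mderiv j (pol_comp_mx Q A) = pol_comp_mx (dder (col j A)^T Q) A.
Proof.
elim/mpoly_ring_ind: Q => [c|i|p q IHp IHq|p q IHp IHq].
- by rewrite pol_comp_mxC mderivC dderC pol_comp_mx0.
- rewrite pol_comp_mxX dderX pol_comp_mxC !mxE raddf_sum (bigD1 j) //=.
  have U0 : mnm_sub (mnm1 j) (mnm1 j) = mnm0.
    by apply/mnmP => k; rewrite mnmBE subnn mnm0E.
  rewrite mderivZ mderivX mnm1E eqxx scale1r U0 mpolyX0 -alg_mpolyC.
  rewrite big1 ?addr0 // => k kj.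
  by rewrite mderivZ mderivX mnm1E (negbTE kj) scale0r scaler0.
- by rewrite pol_comp_mxD mderivD raddfD /= pol_comp_mxD IHp IHq.
- by rewrite pol_comp_mxM mderivM dderM pol_comp_mxD !pol_comp_mxM IHp IHq.
Qed.

Lemma mcoeff0_pol_comp_mx m n (A : 'M[R]_(n, m)) (Q : mpoly n R) :
  mcoeff mnm0 (pol_comp_mx Q A) = mcoeff mnm0 Q.
Proof.
rewrite -!meval0E meval_pol_comp_mx; apply: meval_eq => i.
by rewrite big1 // => j _; rewrite mulr0.
Qed.

(** Differentiating [G o X] in the variables [cs] is differentiating [G] along
    the corresponding columns of [X], by iteration of the chain rule. *)
Lemma ddern_pol_comp_mx q n (X : 'M[R]_(n, q)) (cs : seq 'I_q) (G : mpoly n R) :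
  pol_comp_mx (ddern [seq (col c X)^T | c <- cs] G) X =
  mderivm [multinom count_mem c cs | c < q] (pol_comp_mx G X).
Proof.
elim: cs => [|c cs IH] /=.
  have -> : [multinom count_mem c (@nil (ordinal q)) | c < q] = mnm0.
    by apply/mnmP => c; rewrite !mnmE.
  by rewrite mderivm0m.
rewrite -mderiv_pol_comp_mx IH -mderivmU1m -mderivmDm; congr mderivm.
by apply/mnmP => d; rewrite mnmDE !mnmE addnC.
Qed.

(** Taylor coefficients of [G (X z)] in the parameters [z]: the chain rule turns
    each derivative in [z] into a directional derivative of [G]. *)
Lemma meval0_ddern q n (X : 'M[R]_(n, q)) (cs : seq 'I_q) (G : mpoly n R) :
  meval (fun=> 0) (ddern [seq (col c X)^T | c <- cs] G) =
  (\prod_(c < q) (count_mem c cs)`!)%N%:R *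
    mcoeff [multinom count_mem c cs | c < q] (pol_comp_mx G X).
Proof.
rewrite meval0E -(mcoeff0_pol_comp_mx X) ddern_pol_comp_mx mcoeff_mderivm.
rewrite addm0 mulr_natl.
by under eq_bigr do rewrite mnmE ffactnn.
Qed.

End LinearSubstitution.

(** * Polynomials along polynomial curves *)

Section PolynomialCurves.
Variable R : realType.

(** The composite [G o y] is kept as a formal polynomial in the parameter of the
    curve: its coefficients are the Taylor coefficients at [0]. *)
Definition cpoly n (G : mpoly n R) (y : 'I_n -> {poly R}) : {poly R} :=
  mmap (@polyC R) y G.

Lemma cpolyC n c (y : 'I_n -> {poly R}) : cpoly (mpolyC n c) y = c%:P.
Proof. exact: mmapC. Qed.

Lemma cpolyX n i (y : 'I_n -> {poly R}) : cpoly (mpolyX R (mnm1 i)) y = y i.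
Proof. by rewrite /cpoly mmapX mmap1U. Qed.

Lemma cpolyD n p q (y : 'I_n -> {poly R}) :
  cpoly (p + q) y = cpoly p y + cpoly q y.
Proof. exact: mmapD. Qed.

Lemma cpolyM n p q (y : 'I_n -> {poly R}) :
  cpoly (p * q) y = cpoly p y * cpoly q y.
Proof. exact: rmorphM. Qed.

Lemma cpolyZ n c p (y : 'I_n -> {poly R}) : cpoly (c *: p) y = c *: cpoly p y.
Proof. by rewrite -mul_mpolyC cpolyM cpolyC mul_polyC. Qed.

Lemma cpoly_sum n (I : Type) (r : seq I) (P : pred I) (F : I -> mpoly n R)
    (y : 'I_n -> {poly R}) :
  cpoly (\sum_(i <- r | P i) F i) y = \sum_(i <- r | P i) cpoly (F i) y.
Proof. by rewrite /cpoly raddf_sum. Qed.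

Lemma horner_cpoly n (G : mpoly n R) (y : 'I_n -> {poly R}) t :
  (cpoly G y).[t] = meval (fun i => (y i).[t]) G.
Proof.
elim/mpoly_ring_ind: G => [c|i|p q IHp IHq|p q IHp IHq].
- by rewrite cpolyC mevalC hornerC.
- by rewrite cpolyX mevalXU.
- by rewrite cpolyD hornerD mevalD IHp IHq.
- by rewrite cpolyM hornerM mevalM IHp IHq.
Qed.

Lemma cpoly_pol_comp_mx m n (G : mpoly n R) (X : 'M[R]_(n, m)) z :
  cpoly (pol_comp_mx G X) z = cpoly G (fun i => \sum_c X i c *: z c).
Proof.
elim/mpoly_ring_ind: G => [c|i|p q IHp IHq|p q IHp IHq].
- by rewrite pol_comp_mxC !cpolyC.
- rewrite pol_comp_mxX cpolyX cpoly_sum; apply: eq_bigr => j _.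
  by rewrite cpolyZ cpolyX.
- by rewrite pol_comp_mxD !cpolyD IHp IHq.
- by rewrite pol_comp_mxM !cpolyM IHp IHq.
Qed.

(** A coefficient of order [a] of a product only involves the coefficients of
    the factors up to order [a]. *)
Lemma coef_cpoly_trunc n (G : mpoly n R) (y z : 'I_n -> {poly R}) a :
  (forall i k, (k <= a)%N -> (y i)`_k = (z i)`_k) ->
  (cpoly G y)`_a = (cpoly G z)`_a.
Proof.
move=> yz; suff : forall k, (k <= a)%N -> (cpoly G y)`_k = (cpoly G z)`_k.
  exact.
elim/mpoly_ring_ind: G => [c|i|p q IHp IHq|p q IHp IHq] k ka.
- by rewrite !cpolyC.
- by rewrite !cpolyX yz.
- by rewrite !cpolyD !coefD IHp // IHq.
- rewrite !cpolyM !coefM; apply: eq_bigr => j _.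
  by rewrite IHp ?IHq // ?(leq_trans _ ka) ?leq_subr // -ltnS.
Qed.

(** On a curve [X z] with [z_c = t^(d c)] a monomial [z^k] becomes [t] to the
    power [sum_c d c * k c]. As the weights are positive, a monomial of weight
    [a] has degree at most [a]. *)
Lemma coef_cpoly_mono q n (G : mpoly n R) (X : 'M[R]_(n, q)) (d : 'I_q -> nat)
    a : (forall c, 0 < d c)%N ->
  (cpoly G (fun i => \sum_c X i c *: 'X^(d c)))`_a =
  \sum_(k : bmultinom q a.+1 | (\sum_c d c * (k : multinom q) c)%N == a)
     mcoeff k (pol_comp_mx G X).
Proof.
move=> d0; rewrite -(cpoly_pol_comp_mx G X (fun c => 'X^(d c))).
set P := pol_comp_mx G X.
have wt0 (k : multinom q) : (mdeg k <= \sum_c d c * k c)%N.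
  by rewrite mdegE leq_sum // => c _; rewrite leq_pmull.
have E (k : multinom q) : (polyC (mcoeff k P) * mmap1 (fun c => 'X^(d c)) k)`_a
  =
    if (\sum_c d c * k c)%N == a then mcoeff k P else 0.
  rewrite coefCM /mmap1 /=.
  under eq_bigr do rewrite -exprM.
  rewrite prodrXr coefXn eq_sym.
  by case: eqP => _; rewrite ?mulr1 ?mulr0.
rewrite /cpoly /mmap coef_sum (eq_bigr _ (fun k _ => E k)) -big_mkcond /=.
rewrite (ssrcomplements.big_mksub_cond (bmultinom q a.+1)) ?msupp_uniq //=;
  last first.
  by move=> k _ /eqP <-; rewrite ltnS.
rewrite [RHS](bigID (fun k : bmultinom q a.+1 => (k : multinom q) \in msupp P))
  /=.
rewrite [X in _ + X]big1 ?addr0 => [|k /andP[_ /memN_msupp_eq0//]].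
by apply: eq_bigl => k; rewrite andbC.
Qed.

End PolynomialCurves.

(** * Differentials of polynomial functions *)

Section DifferentialOfPolynomials.
Variables (R : realType) (n : nat).
Implicit Types (G Q : mpoly n R) (x w : 'rV[R]_n).

(** Differentiability and the value of the differential are proved together,
    since the product rule needs both. *)
Lemma is_diff_pol_fun G (I0 : 'rV[R]_n) x :
  differentiable (pol_fun G I0) x /\
  forall w, 'd (pol_fun G I0) x w = pol_fun (dder w G) I0 x.
Proof.
elim/mpoly_ring_ind: G => [c|i|p q [dp IHp] [dq IHq]|p q [dp IHp] [dq IHq]].
- have -> : pol_fun (mpolyC n c) I0 = cst c.
    by apply/funext => y; rewrite /pol_fun mevalC.
  split=> [|w]; first exact: differentiable_cst.
  by rewrite diff_cst dderC /pol_fun meval0.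
- have -> : pol_fun (mpolyX R (mnm1 i)) I0 =
      (fun y : 'rV[R]_n => y 0 i) - cst (I0 0 i).
    by apply/funext => y; rewrite /pol_fun mevalXU !mxE.
  have dc : differentiable (fun y : 'rV[R]_n => y 0 i) x.
    exact: differentiable_coord.
  split=> [|w].
    by apply: differentiableB; [exact: dc|exact: differentiable_cst].
  rewrite diffB; [|exact: dc|exact: differentiable_cst].
  rewrite diff_cst dderX /pol_fun mevalC.
  have lc : linear (fun y : 'rV[R]_n => y 0 i : R^o).
    by move=> a u v; rewrite !mxE.
  pose L : {linear 'rV[R]_n -> R^o} := HB.pack (fun y : 'rV[R]_n => y 0 i : R^o)
    (GRing.isLinear.Build _ _ _ _ _ lc).
  rewrite -[X in 'd X x]/(L : 'rV[R]_n -> R^o) diff_lin;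
    last exact: coord_continuous.
  by rewrite /= subr0.
- have -> : pol_fun (p + q) I0 = pol_fun p I0 + pol_fun q I0.
    by apply/funext => y; rewrite /pol_fun mevalD.
  split=> [|w]; first exact: differentiableD.
  rewrite diffD //= [X in X + _]IHp [X in _ + X]IHq.
  by rewrite dderD /pol_fun mevalD.
- have -> : pol_fun (p * q) I0 = pol_fun p I0 * pol_fun q I0.
    by apply/funext => y; rewrite /pol_fun mevalM.
  split=> [|w]; first exact: differentiableM.
  rewrite diffM //.
  transitivity (pol_fun p I0 x * 'd (pol_fun q I0) x w +
                pol_fun q I0 x * 'd (pol_fun p I0) x w) => //.
  rewrite IHp IHq dderM /pol_fun mevalD !mevalM addrC.
  by rewrite [X in X + _]mulrC.
Qed.

Lemma hdiff_pol_fun Q (I0 : 'rV[R]_n) (ws : seq 'rV[R]_n) :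
  hdiff (pol_fun Q I0) ws = pol_fun (ddern ws Q) I0.
Proof.
elim: ws => //= w ws ->; apply/funext => x.
by have [_ ->] := is_diff_pol_fun (ddern ws Q) I0 x.
Qed.

Lemma hdiff_pol_fun0 Q (I0 : 'rV[R]_n) (ws : seq 'rV[R]_n) :
  hdiff (pol_fun Q I0) ws I0 = meval (fun=> 0) (ddern ws Q).
Proof.
by rewrite hdiff_pol_fun /pol_fun; apply: meval_eq => i; rewrite subrr mxE.
Qed.

End DifferentialOfPolynomials.

Section OneVariable.
Variable R : realType.

Lemma derive1n_horner (p : {poly R}) k :
  (horner p)^`(k)%classic = horner (p^`(k)).
Proof.
elim: k => [|k IH]; first by rewrite derive1n0 derivn0.
by rewrite derive1nS IH -derivE derivnS.
Qed.

Lemma derive1n_horner0 (p : {poly R}) k :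
  (horner p)^`(k)%classic 0 = p`_k * k`!%:R.
Proof.
by rewrite derive1n_horner horner_coef0 coef_derivn addn0 ffactnn mulr_natr.
Qed.

(** Iterated derivatives only depend on the germ; the induction needs the
    equality of the derivatives near [x], not only at [x]. *)
Lemma near_eq_derive1n (f g : R -> R) (x : R) k :
  (\forall t \near x, f t = g t) ->
  (f^`(k)%classic x = g^`(k)%classic x).
Proof.
move=> fg; apply: (@nbhs_singleton _ x (fun t => f^`(k)%classic t =
  g^`(k)%classic t)).
elim: k => [|k IH]; first by rewrite !derive1n0.
have := near_join IH; apply: filterS => t.
rewrite !derive1nS !derive1E; exact: near_eq_derive.
Qed.

(** The Taylor series at [x] is finite: its terms are those of [p] composed with
    the translation ['X + x]. *)
Lemma analytic_at_horner (p : {poly R}) x : analytic_at (horner p) x.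
Proof.
exists (fun k => (p \Po ('X + x%:P))`_k); near=> y.
set q := p \Po _.
have -> : p.[y] = q.[y - x].
  by rewrite /q horner_comp !hornerE subrK.
apply: cvg_near_cst; exists (size q) => // k /= qk.
rewrite /pseries /series /= horner_coef big_mkord.
rewrite (big_ord_widen _ (fun i => q`_i * (y - x) ^+ i) qk) [RHS]big_mkcond /=.
apply: eq_bigr => i _; case: ltnP => // qi.
by rewrite nth_default ?mul0r.
Unshelve. all: by end_near.
Qed.

End OneVariable.

(** * Multi-indices *)

Section FiniteSupportSums.

(** The sums over [mu] and [k] in the definition of [H] range over subsets of
    infinite types and the range of [k] depends on [mu]. Enumerating the pairs
    by a finite type makes them ordinary finite sums. *)
Lemma fsbig_dep_bij (V : nmodType) (K : finType) (I J : choiceType)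
    (A : set I) (B : I -> set J) (P : pred K) (hi : K -> I) (hj : K -> J)
    (F : I -> J -> V) :
  (forall k, P k -> A (hi k) /\ B (hi k) (hj k)) ->
  (forall k k', P k -> P k' -> hi k = hi k' -> hj k = hj k' -> k = k') ->
  (forall i j, A i -> B i j -> exists2 k, P k & hi k = i /\ hj k = j) ->
  \sum_(i \in A) \sum_(j \in B i) F i j = \sum_(k | P k) F (hi k) (hj k).
Proof.
move=> hAB hinj hsurj.
have inner i : A i ->
    \sum_(j \in B i) F i j = \sum_(k | P k && (hi k == i)) F (hi k) (hj k).
  move=> Ai; rewrite (fsbig_fwiden [seq hj k | k in [pred k | P k && (hi k ==
    i)]]).
  - rewrite big_image; apply: eq_bigr => k /andP[_ /eqP ->]//.
  - move=> j /(hsurj _ _ Ai)[k Pk [hik hjk]] /=.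
    by apply/mapP; exists k; rewrite // mem_enum inE Pk hik eqxx.
  - rewrite map_inj_in_uniq ?enum_uniq // => k k'.
    rewrite !mem_enum !inE => /andP[Pk /eqP ki] /andP[Pk' /eqP k'i].
    by apply: hinj => //; rewrite ki k'i.
  - move=> j [/= /mapP[k]]; rewrite mem_enum inE => /andP[Pk /eqP ki] -> [].
    by have [_] := hAB _ Pk; rewrite ki.
pose r := undup [seq hi k | k in P].
rewrite (fsbigE r) ?undup_uniq //; first last.
- move=> i Ai ir; rewrite inner // big1 // => k /andP[Pk /eqP ki].
  case/negP: ir; rewrite mem_undup; apply/mapP; exists k => //.
  by rewrite mem_enum.
- move=> i /=; rewrite mem_undup => /mapP[k]; rewrite mem_enum => Pk ->.
  by have [] := hAB _ Pk.
transitivity (\sum_(i <- r)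
    \sum_(k | P k && (hi k == i)) F (hi k) (hj k)).
  rewrite big_mkcond /=; apply: eq_big_seq => i.
  rewrite mem_undup => /mapP[k]; rewrite mem_enum => Pk ->.
  have [Ai _] := hAB _ Pk.
  by rewrite ifT ?inE // inner.
rewrite (exchange_big_dep P) /= => [|i k _ /andP[]//].
apply: eq_bigr => k Pk.
under eq_bigl do rewrite Pk eq_sym.
rewrite -big_filter filter_pred1_uniq ?undup_uniq ?big_seq1 // mem_undup.
by apply/mapP; exists k; rewrite // mem_enum.
Qed.

End FiniteSupportSums.

Section MultiIndexWords.
Variables (R : realType) (n p s : nat).
Variables (v : 'rV[R]_n) (u : 'M[R]_(p, n)) (a : 'M[R]_(p, s)) (alpha : nat).

(** The curve [t v + sum_j sum_(i >= 2) t^i a_ji u_j] is [X z], where [X] has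
    one column for [v] and one for each [a_ji u_j], and the corresponding
    entries of [z] are [t] and [t^i]. A slot is the index of such a column; as
    for [Gset], the second component [i] of a pair stands for the exponent
    [i.+2]. *)
Definition slot : finType := (unit + 'I_p * 'I_alpha.-1)%type.

Definition slot_vec (c : slot) : 'rV[R]_n :=
  if c is inr ji then acoef a ji.1 ji.2.+2 *: row ji.1 u else v.

Definition slot_wt (c : slot) : nat := if c is inr ji then ji.2.+2 else 1.

Definition slot_mx : 'M[R]_(n, #|slot|) :=
  \matrix_(i, c) slot_vec (enum_val c) 0 i.

(** The list of slots behind the entries [v^{k0}, [au]_k] of [H]; the numbers of
    occurrences in it are the exponents [k0] and [k]. *)
Definition slot_word (k0 : nat) (k : 'M[nat]_(p, alpha.-1)) : seq slot :=
  nseq k0 (inl tt) ++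
  flatten [seq nseq (k j i) (inr (j, i)) | j <- enum 'I_p, i <- enum
    'I_alpha.-1].

Lemma map_slot_vec k0 k :
  [seq slot_vec c | c <- slot_word k0 k] = nseq k0 v ++ au u a k.
Proof.
rewrite /slot_word map_cat map_nseq map_flatten map_allpairs;
  congr (_ ++ flatten _).
by apply: eq_allpairs => j i; rewrite map_nseq.
Qed.

Lemma big_slot (T : Type) (idx : T) (op : Monoid.com_law idx) (F : slot -> T) :
  \big[op/idx]_(c < #|slot|) F (enum_val c) =
  op (F (inl tt)) (\big[op/idx]_j \big[op/idx]_i F (inr (j, i))).
Proof.
rewrite -(big_enum_val F) /=.
rewrite big_sumType /= (big_pred1 tt) => [|[]//]; congr (op _ _).
by rewrite pair_big /=; apply: eq_bigr => -[j i] _.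
Qed.

Lemma count_slot_word_inl k0 k : count_mem (inl tt) (slot_word k0 k) = k0.
Proof.
rewrite count_cat count_nseq /= ?eqxx mul1n count_flatten sumnE big_map
  big1_seq ?addn0 //.
move=> w /andP[_ /allpairsP[[j i] [_ _ ->]]].
by rewrite count_nseq.
Qed.

Lemma count_slot_word_inr k0 (k : 'M[nat]_(p, alpha.-1)) j i :
  count_mem (inr (j, i)) (slot_word k0 k) = k j i.
Proof.
rewrite count_cat count_nseq mul0n add0n count_flatten sumnE big_map.
rewrite big_allpairs_dep /= !big_enum /= (bigD1 j) //= big_enum /= (bigD1 i)
  //=.
rewrite count_nseq /= ?eqxx mul1n !big1 ?addn0 // => [j' jj'|i' ii'].
  rewrite big_enum big1 // => i' _; rewrite count_nseq /=.
  case: eqP => [[E _]|//]; first by rewrite E eqxx in jj'.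
rewrite count_nseq /=.
by case: eqP => [[E]|//]; rewrite E eqxx in ii'.
Qed.

Variable G : mpoly n R.
Implicit Types kap : multinom #|slot|.

(** A monomial in the slots is given by its exponent [kap], which consists of
    the exponent [kap_v] of [v] and of the matrix [kap_u] of the exponents
    [k_ji]. *)
Definition kap_v kap : nat := kap (enum_rank (inl tt : slot)).

Definition kap_u kap : 'M[nat]_(p, alpha.-1) :=
  \matrix_(j, i) kap (enum_rank (inr (j, i) : slot)).

Lemma count_slot_word kap c :
  count_mem (enum_val c) (slot_word (kap_v kap) (kap_u kap)) = kap c.
Proof.
rewrite -[in RHS](enum_valK c); case: (enum_val c) => [[]|[j i]].
  exact: count_slot_word_inl.
by rewrite count_slot_word_inr mxE.
Qed.

(** The coefficient of a monomial is the derivative along its slots divided by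
    the factorials of its exponents. *)
Lemma mcoeff_slot_mx kap :
  mcoeff kap (pol_comp_mx G slot_mx) =
  meval (fun=> 0) (ddern (nseq (kap_v kap) v ++ au u a (kap_u kap)) G) /
    ((kap_v kap)`! * kfact (kap_u kap))%N%:R.
Proof.
pose w := slot_word (kap_v kap) (kap_u kap).
have cw c : count_mem c (map enum_rank w) = kap c.
  rewrite -count_slot_word count_map; apply: eq_count => x /=.
  by rewrite -[RHS](inj_eq enum_rank_inj) enum_valK.
have /(congr1 (fun x => x / ((kap_v kap)`! * kfact (kap_u kap))%N%:R)) :=
  meval0_ddern slot_mx (map enum_rank w) G.
have -> : [multinom count_mem c (map enum_rank w) | c < #|slot|] = kap.
  by apply/mnmP => c; rewrite mnmE cw.
have -> : (\prod_(c < #|slot|) (count_mem c (map enum_rank w))`!)%N =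
    ((kap_v kap)`! * kfact (kap_u kap))%N.
  rewrite (eq_bigr (fun c => (kap (enum_rank (enum_val c)))`!)) => [|c _].
    rewrite (big_slot muln (fun c => (kap (enum_rank c))`!)) /=;
      congr (_ * _)%N.
    by apply: eq_bigr => j _; apply: eq_bigr => i _; rewrite mxE.
  by rewrite cw enum_valK.
have -> : [seq (col c slot_mx)^T | c <- map enum_rank w] =
    nseq (kap_v kap) v ++ au u a (kap_u kap).
  rewrite -map_slot_vec -map_comp; apply: eq_map => c /=.
  by apply/rowP => i; rewrite !mxE enum_rankK.
move=> ->; rewrite [_%:R * _]mulrC mulfK // pnatr_eq0 -lt0n.
rewrite muln_gt0 fact_gt0 /= /kfact.
by apply: prodn_gt0 => j; apply: prodn_gt0 => i; exact: fact_gt0.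
Qed.

Definition kap_wt kap : nat :=
  (kap_v kap + \sum_j \sum_(i < alpha.-1) i.+2 * kap_u kap j i)%N.

(** The Taylor formula behind [H]: the power of [t] carried by a monomial is its
    weight, which is the quantity that [Gset] requires to be [alpha]. *)
Lemma coef_cpoly_curve :
  (cpoly G (fun i => v 0 i *: 'X +
     \sum_(j < p) \sum_(k < alpha.-1) (acoef a j k.+2 * u j i) *:
       'X^(k.+2)))`_alpha =
  \sum_(kap : bmultinom #|slot| alpha.+1 | kap_wt kap == alpha)
    meval (fun=> 0) (ddern (nseq (kap_v kap) v ++ au u a (kap_u kap)) G) /
      ((kap_v kap)`! * kfact (kap_u kap))%N%:R.
Proof.
transitivity (cpoly G (fun i => \sum_c slot_mx i c *: 'X^(slot_wt (enum_val
  c))))`_alpha.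
  apply: coef_cpoly_trunc => i k _; congr (_`_k).
  rewrite (eq_bigr (fun c : 'I_#|slot| =>
    slot_vec (enum_val c) 0 i *: 'X^(slot_wt (enum_val c)))) => [|c _];
      last first.
    by rewrite mxE.
  rewrite (big_slot +%R (fun c => slot_vec c 0 i *: 'X^(slot_wt c))) /= expr1.
  by under [in RHS]eq_bigr do under eq_bigr do rewrite !mxE.
have wt0 (c : 'I_#|slot|) : (0 < slot_wt (enum_val c))%N by case: (enum_val c).
rewrite (coef_cpoly_mono G slot_mx alpha wt0).
apply: eq_big => [kap|kap _]; last exact: mcoeff_slot_mx.
rewrite (eq_bigr (fun c => slot_wt (enum_val c) * kap (enum_rank (enum_val
  c)))%N).
  rewrite (big_slot addn (fun c => slot_wt c * kap (enum_rank c))%N) /= mul1n.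
  by congr (_ + _ == _)%N; do 2![apply: eq_bigr => ? _]; rewrite mxE.
by move=> c _; rewrite enum_valK.
Qed.

End MultiIndexWords.

Section MultiIndexSums.
Variables (p alpha : nat).
Hypothesis alpha_gt0 : (0 < alpha)%N.
Implicit Types (l : 'I_p.+1) (k : 'M[nat]_(p, alpha.-1)) (b : nat).

Notation slot := (slot p alpha).
Notation kapT := (bmultinom #|slot| alpha.+1).
Implicit Types kap : kapT.

Definition kap_of (b : nat) k : multinom #|slot| :=
  [multinom (if enum_val c is inr ji then k ji.1 ji.2 else b) | c < #|slot|].

Lemma kap_vK b k : kap_v (kap_of b k) = b.
Proof. by rewrite /kap_v mnmE enum_rankK. Qed.

Lemma kap_uK b k : kap_u (kap_of b k) = k.
Proof. by apply/matrixP => j i; rewrite mxE mnmE enum_rankK. Qed.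

Lemma kap_ofK (kap : multinom #|slot|) : kap_of (kap_v kap) (kap_u kap) = kap.
Proof.
apply/mnmP => c; rewrite mnmE -[in RHS](enum_valK c).
by case: (enum_val c) => [[]|[j i]] //; rewrite mxE.
Qed.

Lemma mdeg_kap (kap : multinom #|slot|) :
  mdeg kap = (kap_v kap + \sum_j \sum_i kap_u kap j i)%N.
Proof.
rewrite mdegE (eq_bigr (fun c => kap (enum_rank (enum_val c)))) => [|c _].
  rewrite (big_slot addn (fun c => kap (enum_rank c))) /=; congr (_ + _)%N.
  by apply: eq_bigr => j _; apply: eq_bigr => i _; rewrite mxE.
by rewrite enum_valK.
Qed.

Lemma mdeg_kap_le (kap : multinom #|slot|) : (mdeg kap <= kap_wt kap)%N.
Proof.
rewrite mdeg_kap leq_add2l; apply: leq_sum => j _; apply: leq_sum => i _.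
by rewrite leq_pmull.
Qed.

Lemma kap_ofP b k : (b + \sum_j \sum_(i < alpha.-1) i.+2 * k j i = alpha)%N ->
  exists2 kap : kapT, kap_wt kap = alpha & kap_v kap = b /\ kap_u kap = k.
Proof.
move=> wt; have wtE : kap_wt (kap_of b k) = alpha.
  by rewrite /kap_wt kap_vK kap_uK.
have lt : (mdeg (kap_of b k) < alpha.+1)%N by rewrite ltnS -[leqRHS]wtE
  mdeg_kap_le.
by exists (BMultinom lt); rewrite /= ?kap_vK ?kap_uK.
Qed.

Lemma kap_inj kap kap' : kap_v kap = kap_v kap' -> kap_u kap = kap_u kap' ->
  kap = kap'.
Proof. by move=> ev eu; apply: val_inj;
  rewrite /= -[LHS]kap_ofK ev eu kap_ofK. Qed.

(** For [kap] of weight [alpha], the multi-index [mu] such that [kap_u kap] is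
    in [Gset (mu_tilde l mu) alpha]: it also counts the direction [l] in which
    the gradient is taken. *)
Definition kap_mu l (kap : multinom #|slot|) : {ffun 'I_p.+1 -> nat} :=
  [ffun x => ((if unlift ord0 x is Some j then \sum_i kap_u kap j i
               else kap_v kap) + (x == l))%N].

Lemma kap_mu0 l kap : kap_mu l kap ord0 = (kap_v kap + (ord0 == l))%N.
Proof. by rewrite ffunE unlift_none. Qed.

Lemma kap_muS l kap j :
  kap_mu l kap (lift ord0 j) = (\sum_i kap_u kap j i + (lift ord0 j == l))%N.
Proof. by rewrite ffunE liftK. Qed.

Lemma mlen_kap_mu l kap : mlen (kap_mu l kap) = (mdeg kap).+1.
Proof.
rewrite /mlen mdeg_kap big_ord_recl kap_mu0.
rewrite (eq_bigr _ (fun j _ => kap_muS l kap j)).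
rewrite big_split /= addnACA -[RHS]addn1; congr (_ + _)%N.
rewrite -(big_ord_recl _ (fun x => (x == l : nat))) (bigD1 l) //= eqxx big1 //.
by move=> x /negbTE ->.
Qed.

(** The monomials whose multi-index is one of the [nu (i, beta)], which [Mset]
    leaves out. *)
Definition exceptional l kap :=
  `[< exists i beta, (1 <= beta <= alpha)%N /\ kap_mu l kap = nu i beta >].

(** The map [kap |-> (kap_mu l kap, kap_u kap)] is a bijection from the
    monomials of weight [alpha] that are not exceptional onto the pairs [(mu,
    k)] of the definition of [H]. Injectivity: [mu] determines the exponent of
    [v] once the contribution of [l] is subtracted. *)
Lemma sum_mu_k (V : nmodType) l (F : nat -> 'M[nat]_(p, alpha.-1) -> V) :
  \sum_(mu \in Eset l alpha `&` Mset alpha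
               `&` [set mu : {ffun 'I_p.+1 -> nat} | mu l != 0%N])
     \sum_(k \in Gset (mu_tilde l mu) alpha) F (mu ord0 - (ord0 == l))%N k =
  \sum_(kap : kapT | (kap_wt kap == alpha) && ~~ exceptional l kap)
     F (kap_v kap) (kap_u kap).
Proof.
rewrite (fsbig_dep_bij (K := kapT)
  (P := fun kap => (kap_wt kap == alpha) && ~~ exceptional l kap)
  (hi := fun kap => kap_mu l kap) (hj := fun kap => kap_u kap)).
- by apply: eq_bigr => kap _; rewrite kap_mu0 addnK.
- move=> kap /andP[/eqP wt ex].
  have G : Gset (mu_tilde l (kap_mu l kap)) alpha (kap_u kap).
    split=> [j|]; first by rewrite /mu_tilde kap_muS PoszD addrK.
    by rewrite /mu_tilde kap_mu0 PoszD addrK -PoszD -[X in _ = Posz X]wt.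
  split=> //; split; [split|].
  + by exists (kap_u kap).
  + split; last by move: ex => /asboolPn.
    have le := mdeg_kap_le kap; rewrite wt in le.
    rewrite /= mlen_kap_mu !ltnS le andbT lt0n.
    apply/eqP => /eqP; rewrite mdeg_eq0 => /eqP k0.
    move: wt; rewrite k0 /kap_wt /kap_v mnm0E big1 => [E|j _].
      by have : (0 < 0 + 0)%N by rewrite E.
    by rewrite big1 // => i _; rewrite mxE mnm0E muln0.
  + by rewrite /= ffunE eqxx addn1.
- move=> kap kap' _ _ /ffunP emu eu; apply: kap_inj => //.
  by have := emu ord0; rewrite !kap_mu0 => /addIn.
- move=> mu k [[_ [Ml Mn]] mul0] [Gj G0].
  (* The condition [mu l != 0] makes this natural number subtraction exact. *)
  have mu0 : (mu ord0 = (mu ord0 - (ord0 == l)) + (ord0 == l))%N.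
    by rewrite subnK //; move: mul0; case: eqP => [<-|//]; rewrite /= lt0n.
  have wt : ((mu ord0 - (ord0 == l)) + \sum_j \sum_(i < alpha.-1) i.+2 * k j i
             = alpha)%N.
    move: G0; rewrite /mu_tilde {1}mu0 PoszD addrK -PoszD.
    by case.
  have [kap wtk [kv ku]] := kap_ofP wt.
  have E : kap_mu l kap = mu.
    apply/ffunP => x; case: (unliftP ord0 x) => [j|] ->.
      rewrite kap_muS ku; apply/eqP; rewrite -eqz_nat PoszD Gj /mu_tilde.
      by rewrite subrK.
    by rewrite kap_mu0 kv -mu0.
  exists kap => //; rewrite wtk eqxx; apply/asboolPn; rewrite E; exact: Mn.
Qed.

(** The exponents of the monomial with the single factor [a_j(i+2) u_j]. *)
Definition unit_mx_nat j i : 'M[nat]_(p, alpha.-1) :=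
  \matrix_(j', i') ((j' == j) && (i' == i) : nat).

Lemma mx_nat_le1 (k : 'M[nat]_(p, alpha.-1)) :
  reflect (k = const_mx 0%N \/ exists j i, k = unit_mx_nat j i)
          (\sum_j \sum_i k j i <= 1)%N.
Proof.
rewrite pair_bigA /=; apply: (iffP idP) => [le1|[->|[j [i ->]]]]; last 2 first.
- by rewrite big1 // => ji _; rewrite mxE.
- rewrite (bigD1 (j, i)) //= mxE !eqxx big1 // => -[j' i'] /= ji.
  by rewrite mxE -xpair_eqE (negbTE ji).
case: (pickP (fun ji => k ji.1 ji.2 != 0%N)) => [[j i] /= kji|k0]; last first.
  left; apply/matrixP => j i; rewrite mxE; apply/eqP.
  by have /negbFE := k0 (j, i).
right; exists j, i; move: le1; rewrite (bigD1 (j, i)) //=.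
set S := (\sum_(_ | _) _)%N => le1.
have [kE S0] : k j i = 1%N /\ S = 0%N.
  by move: kji le1; case: (k j i) => [|[|m]] //; case: S.
apply/matrixP => j' i'; rewrite mxE.
case: (boolP ((j' == j) && (i' == i))) => [/andP[/eqP-> /eqP->]//|ne].
move/eqP: S0; rewrite sum_nat_eq0 => /forall_inP/(_ (j', i')).
by rewrite xpair_eqE ne => /(_ isT)/eqP.
Qed.

Lemma wt_unit_mx_nat j i :
  (\sum_j' \sum_(i' < alpha.-1) i'.+2 * unit_mx_nat j i j' i' = i.+2)%N.
Proof.
rewrite pair_bigA (bigD1 (j, i)) //= mxE !eqxx muln1 big1 ?addn0 //.
move=> [j' i'] ne.
by rewrite mxE -xpair_eqE (negbTE ne) muln0.
Qed.

Lemma wt_const0 :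
  (\sum_(j < p) \sum_(i < alpha.-1)
     i.+2 * (const_mx 0%N : 'M[nat]_(p, alpha.-1)) j i = 0)%N.
Proof.
by rewrite big1 // => j _; rewrite big1 // => i _; rewrite mxE muln0.
Qed.

Lemma ord_pred_le (i : 'I_alpha.-1) : (i.+2 <= alpha)%N.
Proof. by have := ltn_ord i; rewrite ltn_predRL. Qed.

Lemma lift_eq0 (j : 'I_p) : (lift ord0 j == ord0) = false.
Proof. by rewrite eq_sym (negbTE (neq_lift _ _)). Qed.

(** For [l > 1], [mu l >= 1] forces [nu (i, beta)] to be [nu (l, beta)], which
    leaves no room for a factor [u_j] besides the one of the direction [l]. *)
Lemma exceptional_lift j0 kap : kap_wt kap = alpha ->
  exceptional (lift ord0 j0) kap = (kap_u kap == const_mx 0%N).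
Proof.
set l := lift _ _ => wt; apply/asboolP/eqP => [[i [beta [_ E]]]|k0].
  have il : i = l.
    move/ffunP/(_ l): E; rewrite {1}/l kap_muS -/l ffunE eqxx.
    by rewrite [l == ord0]lift_eq0 muln0; case: eqP => // _; rewrite addn1.
  apply/matrixP => j i'; rewrite [RHS]mxE.
  move/ffunP/(_ (lift ord0 j)): E; rewrite kap_muS ffunE il.
  rewrite lift_eq0 muln0 => /eqP; rewrite eqn_add2r.
  by rewrite sum_nat_eq0 => /forall_inP/(_ i' isT)/eqP.
have kv : kap_v kap = alpha by rewrite -[RHS]wt /kap_wt k0 wt_const0 addn0.
exists l, alpha; rewrite alpha_gt0 leqnn; split=> //.
apply/ffunP => x; case: (unliftP ord0 x) => [j|] ->.
  rewrite kap_muS ffunE lift_eq0 muln0 k0.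
  by rewrite big1 // => i _; rewrite mxE.
by rewrite kap_mu0 ffunE eqxx muln1 kv.
Qed.

(** For [l = 1], [nu (1, alpha)] is the power of [v], and [nu (i, beta)] with [i
    > 1] is that of a single factor [u_i], of weight [alpha - (beta - 1)], next
    to [v^(beta - 1)]; the last [v] is the direction of the derivative. *)
Lemma exceptional_ord0 kap : kap_wt kap = alpha ->
  exceptional ord0 kap = (\sum_j \sum_i kap_u kap j i <= 1)%N.
Proof.
move=> wt; apply/asboolP/idP => [[i [beta [_ E]]]|/mx_nat_le1].
  have Ej j : (\sum_i kap_u kap j i)%N = (lift ord0 j == i) :> nat.
    move/ffunP/(_ (lift ord0 j)): E; rewrite kap_muS ffunE.
    by rewrite lift_eq0 addn0 muln0.
  rewrite (eq_bigr _ (fun j _ => Ej j)).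
  case: (unliftP ord0 i) => [j|] ->.
    rewrite (bigD1 j) //= eqxx big1 // => j' jj'.
    by rewrite (inj_eq lift_inj) (negbTE jj').
  by rewrite big1 // => j _; rewrite lift_eq0.
case=> [k0|[j [i kE]]].
  have kv : kap_v kap = alpha by rewrite -[RHS]wt /kap_wt k0 wt_const0 addn0.
  exists ord0, alpha; rewrite alpha_gt0 leqnn; split=> //.
  apply/ffunP => x; case: (unliftP ord0 x) => [j|] ->.
    rewrite kap_muS ffunE lift_eq0 muln0 k0.
    by rewrite big1 // => i _; rewrite mxE.
  by rewrite kap_mu0 ffunE eqxx muln1 kv.
have kv : (kap_v kap + i.+2 = alpha)%N.
  by rewrite -[RHS]wt /kap_wt kE wt_unit_mx_nat.
exists (lift ord0 j), (kap_v kap).+1; split.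
  by rewrite /= -[X in (_ < X)%N]kv -addn1 leq_add2l.
apply/ffunP => x; case: (unliftP ord0 x) => [j'|] ->.
  rewrite kap_muS ffunE lift_eq0 muln0 addn0 kE.
  rewrite (inj_eq lift_inj) (bigD1 i) //= mxE eqxx andbT.
  by rewrite big1 ?addn0 // => i' ii'; rewrite mxE (negbTE ii') andbF.
by rewrite kap_mu0 ffunE eqxx muln1 (negbTE (neq_lift _ _)) addn0 addn1.
Qed.

Lemma sum_kap_lift (V : nmodType) j0 (F : nat -> 'M[nat]_(p, alpha.-1) -> V) :
  \sum_(kap : kapT | kap_wt kap == alpha) F (kap_v kap) (kap_u kap) =
  F alpha (const_mx 0%N) +
  \sum_(kap : kapT | (kap_wt kap == alpha) && ~~ exceptional (lift ord0 j0) kap)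
     F (kap_v kap) (kap_u kap).
Proof.
rewrite (bigID (exceptional (lift ord0 j0))) /=; congr (_ + _).
have [kap wt [kv ku]] : exists2 kap : kapT, kap_wt kap = alpha &
    kap_v kap = alpha /\ kap_u kap = const_mx 0%N.
  by apply: kap_ofP; rewrite wt_const0 addn0.
rewrite (big_pred1 kap) ?kv ?ku // => kap' /=;
  apply/andP/eqP => [[/eqP wt']|->].
  rewrite exceptional_lift // => /eqP ku'; apply: kap_inj;
    rewrite ?ku ?ku' // kv.
  by rewrite -[RHS]wt' /kap_wt ku' wt_const0 addn0.
by rewrite wt eqxx exceptional_lift // ku.
Qed.

Lemma sum_kap_ord0 (V : nmodType) (F : nat -> 'M[nat]_(p, alpha.-1) -> V) :
  \sum_(kap : kapT | kap_wt kap == alpha) F (kap_v kap) (kap_u kap) =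
  F alpha (const_mx 0%N) +
  \sum_j \sum_(i < alpha.-1) F (alpha - i.+2)%N (unit_mx_nat j i) +
  \sum_(kap : kapT | (kap_wt kap == alpha) && ~~ exceptional ord0 kap)
     F (kap_v kap) (kap_u kap).
Proof.
rewrite (bigID (exceptional ord0)) /=; congr (_ + _).
pose b (c : slot) := if c is inr ji then (alpha - ji.2.+2)%N else alpha.
pose k (c : slot) := if c is inr ji then unit_mx_nat ji.1 ji.2 else const_mx
  0%N.
have hP (c : slot) : exists kap : kapT,
    [/\ kap_wt kap = alpha, kap_v kap = b c & kap_u kap = k c].
  have [|kap wt [kv ku]] := @kap_ofP (b c) (k c); last by exists kap.
  case: c => [[]|[j i]]; rewrite /b /k ?wt_const0 ?addn0 //=.
  by rewrite wt_unit_mx_nat subnK ?ord_pred_le.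
have [h hE] := choice hP.
have hinj : injective h.
  move=> c c' E; have [_ _ kc] := hE c; have [_ _] := hE c'.
  rewrite -E {}kc {E}; case: c c' => [[]|[j i]] [[]|[j' i']] //= /matrixP.
  - by move=> /(_ j' i'); rewrite !mxE !eqxx.
  - by move=> /(_ j i); rewrite !mxE !eqxx.
  - move=> /(_ j i); rewrite !mxE !eqxx /=; case: andP => // -[/eqP-> /eqP->]//.
transitivity (\sum_(kap in imset h (mem slot)) F (kap_v kap) (kap_u kap)).
  apply: eq_bigl => kap; apply/andP/imsetP => [[/eqP wt]|[c _ ->]].
    rewrite exceptional_ord0 // => /mx_nat_le1 k1.
    have [c kE] : exists c, kap_u kap = k c.
      by case: k1 => [->|[j [i ->]]]; [exists (inl tt)|exists (inr (j, i))].
    have [wtc hv hu] := hE c; exists c => //; apply: kap_inj;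
      last by rewrite hu.
    apply/eqP; rewrite -(eqn_add2r (\sum_j \sum_(i < alpha.-1) i.+2 * k c j i)).
    by rewrite -{1}kE -hu; apply/eqP;
      rewrite -/(kap_wt kap) -/(kap_wt (h c)) wt wtc.
  have [wtc hv hu] := hE c; rewrite wtc eqxx exceptional_ord0 // hu; split=> //.
  apply/mx_nat_le1; case: (c) => [[]|[j i]]; first by left.
  by right; exists j, i.
rewrite big_imset /=; last by move=> c c' _ _; exact: hinj.
transitivity (\sum_(c : slot) F (b c) (k c)).
  by apply: eq_bigr => c _; have [_ -> ->] := hE c.
rewrite big_sumType /= (big_pred1 tt) => [|[]//]; congr (_ + _).
by rewrite pair_big /=; apply: eq_bigr => -[j i] _.
Qed.

End MultiIndexSums.

(** In order [1], and for [l = 1] also in order [2], all monomials are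
    exceptional, so that the sums over [mu] are empty there. *)
Section LowOrders.
Variables (p alpha : nat).
Implicit Types kap : bmultinom #|slot p alpha| alpha.+1.

Lemma leq_double_kap_u kap :
  (2 * (\sum_j \sum_i kap_u kap j i) <= kap_wt kap)%N.
Proof.
apply: leq_trans (leq_addl _ _); rewrite big_distrr /=; apply: leq_sum => j _.
by rewrite big_distrr /=; apply: leq_sum => i _; rewrite leq_mul2r orbC.
Qed.

Lemma all_exceptional_lift j0 kap : alpha = 1%N -> kap_wt kap = alpha ->
  exceptional (lift ord0 j0) kap.
Proof.
move=> alpha1 wt; rewrite exceptional_lift ?alpha1 //.
apply/eqP/matrixP => j [i ilt]; exfalso; move: (ilt).
by rewrite [in X in (_ < X)%N]alpha1.
Qed.

Lemma all_exceptional_ord0 kap : (0 < alpha <= 2)%N -> kap_wt kap = alpha ->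
  exceptional ord0 kap.
Proof.
move=> /andP[alpha0 alpha2] wt; rewrite exceptional_ord0 //.
have := leq_double_kap_u kap; rewrite wt => /leq_trans /(_ alpha2).
by rewrite mul2n -[2%N]/(1.*2) leq_double.
Qed.

End LowOrders.

(** * The functions H as Taylor coefficients *)

Section TaylorCoefficients.
Variables (R : realType) (n p s : nat) (Q : mpoly n R) (I0 : 'rV[R]_n).
Variables (v : 'rV[R]_n) (u : 'M[R]_(p, n)) (a : 'M[R]_(p, s)).

(** The terms of the curve [t v + sum_j sum_(i >= 2) t^i a_ji u_j] of order at
    most [d], for [d >= 1]. *)
Definition curve (d : nat) (i : 'I_n) : {poly R} :=
  v 0 i *: 'X +
  \sum_(j < p) \sum_(k < d.-1) (acoef a j k.+2 * u j i) *: 'X^(k.+2).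

(** As the coefficient of order [alpha] does not see the higher terms of the
    curve, cutting the curve at [alpha] gives exponent matrices [k] of the size
    used in [Gset]. *)
Definition Taylor_coef (e : 'rV[R]_n) (alpha : nat) : R :=
  (cpoly (dder e Q) (curve alpha))`_alpha.

Definition Taylor_term (e : 'rV[R]_n) alpha b (k : 'M[nat]_(p, alpha.-1)) : R :=
  meval (fun=> 0) (ddern (nseq b v ++ au u a k) (dder e Q)) /
    (b`! * kfact k)%N%:R.

Lemma Taylor_coefE e alpha :
  Taylor_coef e alpha =
  \sum_(kap : bmultinom #|slot p alpha| alpha.+1 | kap_wt kap == alpha)
    Taylor_term e (kap_v kap) (kap_u kap).
Proof. exact: coef_cpoly_curve. Qed.

Lemma au_const0 alpha : au u a (const_mx 0%N : 'M[nat]_(p, alpha.-1)) = [::].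
Proof.
rewrite /au; apply/size0nil; rewrite size_flatten /shape sumnE !big_map.
rewrite big_allpairs_dep; apply: big1 => j _; apply: big1 => i _.
by rewrite size_nseq mxE.
Qed.

Lemma flatten_nseq_pred1 (T : eqType) (S : Type) (r : seq T) (x : T)
    (f : T -> S) : uniq r -> x \in r ->
  flatten [seq nseq (y == x) (f y) | y <- r] = [:: f x].
Proof.
elim: r => //= y r IH /andP[yr ur]; rewrite inE;
  case: (eqVneq y x) => [E|yx] /=.
  move=> _; rewrite E in yr *; congr (_ :: _).
  elim: r yr {IH ur} => //= z r IH; rewrite inE negb_or => /andP[xz xr].
  by rewrite eq_sym (negbTE xz) IH.
exact: IH.
Qed.

Lemma au_unit alpha (j : 'I_p) (i : 'I_alpha.-1) :
  au u a (unit_mx_nat j i) = [:: acoef a j i.+2 *: row j u].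
Proof.
rewrite /au -(flatten_nseq_pred1 (x := (j, i))
  (fun ji => acoef a ji.1 ji.2.+2 *: row ji.1 u) (r := allpairs pair (enum
    'I_p) (enum 'I_alpha.-1))).
- rewrite map_allpairs; congr flatten; apply: eq_allpairs => j' i'.
  by rewrite mxE xpair_eqE.
- by apply: allpairs_uniq; rewrite ?enum_uniq // => -[? ?] [? ?] _ _ [-> ->].
- by apply/allpairsP; exists (j, i); rewrite !mem_enum.
Qed.

Lemma kfact_const0 alpha : kfact (const_mx 0%N : 'M[nat]_(p, alpha.-1)) = 1%N.
Proof.
by rewrite /kfact big1 // => j _; rewrite big1 // => i _; rewrite mxE.
Qed.

Lemma kfact_unit alpha (j : 'I_p) (i : 'I_alpha.-1) :
  kfact (unit_mx_nat j i) = 1%N.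
Proof.
rewrite /kfact big1 // => j' _; rewrite big1 // => i' _; rewrite mxE.
by case: (_ && _).
Qed.

Lemma hdiff_rcons (ws : seq 'rV[R]_n) e :
  hdiff (pol_fun Q I0) (ws ++ [:: e]) I0 =
  meval (fun=> 0) (ddern ws (dder e Q)).
Proof. by rewrite hdiff_pol_fun0 ddern_cat. Qed.

Definition Hj_sum j alpha :=
  \sum_(mu \in Eset (lift ord0 j) alpha `&` Mset alpha
         `&` [set mu : {ffun 'I_p.+1 -> nat} | mu (lift ord0 j) != 0%N])
     \sum_(k \in Gset (mu_tilde (lift ord0 j) mu) alpha)
        hdiff (pol_fun Q I0) (nseq (mu ord0) v ++ au u a k ++ [:: row j u]) I0
          / ((mu ord0)`! * kfact k)%N%:R.

Definition H1_sum alpha :=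
  \sum_(mu \in Eset ord0 alpha `&` Mset alpha
                   `&` [set mu : {ffun 'I_p.+1 -> nat} | mu ord0 != 0%N])
        \sum_(k \in Gset (mu_tilde ord0 mu) alpha)
          hdiff (pol_fun Q I0) (nseq (mu ord0 - 1)%N v ++ au u a k ++ [:: v]) I0
            / ((mu ord0 - 1)`! * kfact k)%N%:R.

Lemma Hj_sumE j alpha : (0 < alpha)%N ->
  Hj_sum j alpha =
  \sum_(kap : bmultinom #|slot p alpha| alpha.+1 |
           (kap_wt kap == alpha) && ~~ exceptional (lift ord0 j) kap)
     Taylor_term (row j u) (kap_v kap) (kap_u kap).
Proof.
move=> alpha0; rewrite -(sum_mu_k alpha0).
apply: eq_fsbigr => mu _; apply: eq_fsbigr => k _.
by rewrite /Taylor_term (negbTE (neq_lift _ _)) subn0 catA hdiff_rcons.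
Qed.

Lemma H1_sumE alpha : (0 < alpha)%N ->
  H1_sum alpha =
  \sum_(kap : bmultinom #|slot p alpha| alpha.+1 |
           (kap_wt kap == alpha) && ~~ exceptional ord0 kap)
     Taylor_term v (kap_v kap) (kap_u kap).
Proof.
move=> alpha0; rewrite -(sum_mu_k alpha0).
apply: eq_fsbigr => mu _; apply: eq_fsbigr => k _.
by rewrite /Taylor_term eqxx catA hdiff_rcons.
Qed.

Lemma Hj_sum_order1 j : Hj_sum j 1 = 0.
Proof.
rewrite Hj_sumE // big1 // => kap /andP[/eqP wt].
by rewrite all_exceptional_lift.
Qed.

Lemma H1_sum_order12 alpha : (0 < alpha <= 2)%N -> H1_sum alpha = 0.
Proof.
move=> alpha12; rewrite H1_sumE; last by case/andP: alpha12.
by rewrite big1 // => kap /andP[/eqP wt]; rewrite all_exceptional_ord0.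
Qed.

Lemma Hj_Taylor j alpha : (0 < alpha)%N ->
  (alpha`!%:R)^-1 * hdiff (pol_fun Q I0) (nseq alpha v ++ [:: row j u]) I0
    + Hj_sum j alpha = Taylor_coef (row j u) alpha.
Proof.
move=> alpha0; rewrite Taylor_coefE.
rewrite (sum_kap_lift alpha0 j (@Taylor_term (row j u) alpha)); congr (_ + _).
  by rewrite hdiff_rcons /Taylor_term au_const0 cats0 kfact_const0 muln1 mulrC.
exact: Hj_sumE.
Qed.

(** For [beta] between [1] and [alpha - 1], the terms with a single factor [u_i]
    have exponent [beta - 1] for [v]; the remaining entry [v] is the direction
    in which the gradient is taken. *)
Lemma H1_Taylor alpha : (0 < alpha)%N ->
  (alpha`!%:R)^-1 * hdiff (pol_fun Q I0) (nseq alpha.+1 v) I0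
    + \sum_(1 <= beta < alpha) ((beta - 1)`!%:R)^-1 *
        hdiff (pol_fun Q I0) (nseq beta v ++
          [:: \sum_(i < p) acoef a i (alpha - (beta - 1))%N *: row i u]) I0
    + H1_sum alpha = Taylor_coef v alpha.
Proof.
move=> alpha0; rewrite Taylor_coefE.
rewrite (sum_kap_ord0 alpha0 (@Taylor_term v alpha)); congr (_ + _ + _).
- rewrite -[alpha.+1]addn1 nseqD hdiff_rcons /Taylor_term au_const0 cats0.
  by rewrite kfact_const0 muln1 mulrC.
- rewrite big_rev_mkord subn1 exchange_big; apply: eq_bigr => i _ /=.
  have ia := ord_pred_le i.
  have -> : (alpha - i.+1 = (alpha - i.+2).+1)%N by rewrite subnSK.
  rewrite subSS subn0 subKn //.
  rewrite hdiff_rcons dderl_sum ddern_sum raddf_sum mulr_sumr.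
  apply: eq_bigr => j _; rewrite /Taylor_term au_unit kfact_unit muln1 mulrC.
  congr (_ / _); rewrite -[(_ - _).+1]addn1 nseqD !ddern_cat /=.
  by rewrite dder_comm.
exact: H1_sumE.
Qed.

Lemma Taylor_coef0 e : Taylor_coef e 0 = meval (fun=> 0) (dder e Q).
Proof.
rewrite /Taylor_coef -horner_coef0 horner_cpoly; apply: meval_eq => i.
by rewrite /curve !hornerE big1 ?hornerE ?addr0 // => j _; rewrite big_ord0.
Qed.

Lemma Hj_TaylorE j alpha : (0 < alpha)%N ->
  Hj (pol_fun Q I0) I0 v u a j alpha = Taylor_coef (row j u) alpha.
Proof.
move=> alpha0; rewrite -Hj_Taylor //; case: alpha alpha0 => [|[|alpha]] // _.
by rewrite Hj_sum_order1 addr0 invr1 mul1r.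
Qed.

Lemma H1_TaylorE alpha : (0 < alpha)%N -> alpha != 2%N ->
  H1 (pol_fun Q I0) I0 v u a alpha = Taylor_coef v alpha.
Proof.
move=> alpha0; rewrite -H1_Taylor //;
  case: alpha alpha0 => [|[|[|alpha]]] // _ _.
by rewrite H1_sum_order12 // big_geq // !addr0 invr1 mul1r.
Qed.

(** In order [2] the definition of [H] drops the factor [1/2] and the terms
    [a_j2 Q^2[v, u_j]], which are multiples of the [H] of order [1]. *)
Lemma H1_Taylor2 :
  Taylor_coef v 2 = 2^-1 * H1 (pol_fun Q I0) I0 v u a 2 +
    \sum_j acoef a j 2 * Taylor_coef (row j u) 1.
Proof.
rewrite -H1_Taylor // H1_sum_order12 // addr0; congr (_ + _).
rewrite big_nat1 subnn invr1 mul1r -[_ ++ _]/([:: v] ++ [:: _]).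
rewrite hdiff_rcons dderl_sum ddern_sum raddf_sum; apply: eq_bigr => j _.
rewrite -Hj_TaylorE //.
transitivity (acoef a j 2 *
    hdiff (pol_fun Q I0) ([:: v] ++ [:: row j u]) I0) => //.
by rewrite hdiff_rcons /= dderlZ linearZ /= mevalZ.
Qed.

Lemma calH_eq0P :
  (forall l alpha, (1 <= alpha <= s)%N ->
     calH (pol_fun Q I0) I0 v u a l alpha = 0) <->
  (forall alpha, (1 <= alpha <= s)%N ->
     Taylor_coef v alpha = 0 /\ forall j, Taylor_coef (row j u) alpha = 0).
Proof.
split=> H.
  have Tj j b : (1 <= b <= s)%N -> Taylor_coef (row j u) b = 0.
    move=> b1s; rewrite -Hj_TaylorE; last by case/andP: b1s.
    by have := H (lift ord0 j) _ b1s; rewrite /calH liftK.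
  move=> alpha a1s; split=> [|j]; last exact: Tj.
  have := H ord0 _ a1s; rewrite /calH unlift_none.
  have [E|a2] := eqVneq alpha 2%N; last first.
    by rewrite H1_TaylorE //; case/andP: a1s.
  rewrite {alpha}E in a1s *; move=> H12;
    rewrite H1_Taylor2 H12 mulr0 add0r big1 // => j _.
  by rewrite Tj ?mulr0 //; case/andP: a1s => /leq_trans; apply.
move=> l alpha a1s; have [T1 Tj] := H _ a1s.
have a0 : (0 < alpha)%N by case/andP: a1s.
rewrite /calH; case: (unliftP ord0 l) => [j|] _; first by rewrite Hj_TaylorE.
have [E|a2] := eqVneq alpha 2%N; last by rewrite H1_TaylorE.
rewrite {alpha a0}E in a1s T1 Tj *.
move: T1; rewrite H1_Taylor2 [X in _ + X]big1 ?addr0 => [/eqP|j _].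
  by rewrite mulf_eq0 invr_eq0 pnatr_eq0 => /eqP.
have [|_ ->] := H 1%N; last by rewrite mulr0.
by case/andP: a1s => _ /ltnW.
Qed.

End TaylorCoefficients.

(** * The projection of the algebraic set *)

Section GradientAlongJets.
Variables (R : realType) (n : nat).

(** The components [x_1 = t], [x_j = sum_(1 <= k <= s) a_jk t^k] of the jet of a
    curve of the bad set, in the basis formed by the rows of [U]. *)
Definition jet_poly p s (a : 'M[R]_(p, s)) (l : 'I_p.+1) : {poly R} :=
  if unlift ord0 l is Some j then \sum_(k < s) a j k *: 'X^(k.+1) else 'X.

(** The common form of the equations of the algebraic set and of the
    [s]-vanishing of [Q o U^T]. *)
Definition flat_along_jet p s (Q : mpoly n R) (U : 'M[R]_(p.+1, n))
    (a : 'M[R]_(p, s)) : Prop :=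
  forall l alpha, (alpha <= s)%N ->
    (cpoly (dder (row l U) Q) (fun i => \sum_l' U l' i *: jet_poly a l'))`_alpha
    = 0.

Lemma jet_poly0 p s (a : 'M[R]_(p, s)) : jet_poly a ord0 = 'X.
Proof. by rewrite /jet_poly unlift_none. Qed.

Lemma jet_polyS p s (a : 'M[R]_(p, s)) j :
  jet_poly a (lift ord0 j) = \sum_(k < s) a j k *: 'X^(k.+1).
Proof. by rewrite /jet_poly liftK. Qed.

Lemma acoefE p s (a : 'M[R]_(p, s)) j (k : 'I_s) : acoef a j k.+1 = a j k.
Proof.
rewrite /acoef /=; case: insubP => [k' _ E|]; last by rewrite ltn_ord.
by congr (a j _); exact: val_inj.
Qed.

Lemma col_mx_ord0 p (u1 : 'rV[R]_n) (u : 'M[R]_(p, n)) i :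
  (col_mx u1 u : 'M[R]_(p.+1, n)) ord0 i = u1 0 i.
Proof. by rewrite -(col_mxEu u1 u); congr (col_mx _ _ _ _); exact: val_inj. Qed.

Lemma col_mx_lift p (u1 : 'rV[R]_n) (u : 'M[R]_(p, n)) j i :
  (col_mx u1 u : 'M[R]_(p.+1, n)) (lift ord0 j) i = u j i.
Proof. by rewrite -(col_mxEd u1 u); congr (col_mx _ _ _ _); exact: val_inj. Qed.

Lemma curve_jet_poly p s (u1 : 'rV[R]_n) (u : 'M[R]_(p, n)) (a : 'M[R]_(p, s))
    (v : 'rV[R]_n) i : (0 < s)%N ->
  v = u1 + \sum_(j < p) acoef a j 1 *: row j u ->
  curve v u a s i = \sum_l (col_mx u1 u : 'M[R]_(p.+1, n)) l i *: jet_poly a l.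
Proof.
move=> s0 vE; rewrite big_ord_recl jet_poly0.
rewrite col_mx_ord0.
rewrite /curve vE !mxE summxE scalerDl -addrA; congr (_ + _).
rewrite scaler_suml -big_split; apply: eq_bigr => j _ /=.
rewrite col_mx_lift.
rewrite jet_polyS scaler_sumr !mxE.
case: s a s0 {vE} => // s a _ /=; rewrite big_ord_recl; congr (_ + _).
  by rewrite expr1 scalerA mulrC -(acoefE a j ord0).
apply: eq_bigr => k _; rewrite scalerA [X in X *: _]mulrC.
by rewrite -(acoefE a j (lift ord0 k)).
Qed.

(** The equations of the algebraic set are the vanishing of the Taylor
    coefficients for the directions [v, u_2, .., u_m], order [0] coming from the
    conditions on [Q^1]. Since [v - u_1] is a combination of the [u_j],
    replacing [v] by [u_1] changes nothing. *)
Lemma Zm_eqs_flatP p s (Q : mpoly n R) (I0 : 'rV[R]_n) (u1 v : 'rV[R]_n)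
    (u : 'M[R]_(p, n)) (a : 'M[R]_(p, s)) : (0 < s)%N ->
  v = u1 + \sum_(j < p) acoef a j 1 *: row j u ->
  ((hdiff (pol_fun Q I0) [:: v] I0 = 0 /\
      forall j : 'I_p, hdiff (pol_fun Q I0) [:: row j u] I0 = 0) /\
   \sum_(l < p.+1) \sum_(1 <= alpha < s.+1)
      `|calH (pol_fun Q I0) I0 v u a l alpha| = 0) <->
  flat_along_jet Q (col_mx u1 u : 'M[R]_(p.+1, n)) a.
Proof.
move=> s0 vE.
(* All orders [alpha] are read off the same curve, cut at [s]. *)
pose T e alpha := (cpoly (dder e Q) (curve v u a s))`_alpha.
have TE e alpha : (alpha <= s)%N -> Taylor_coef Q v u a e alpha = T e alpha.
  move=> le; apply: coef_cpoly_trunc => i k ka; rewrite /curve !coefD;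
    congr (_ + _).
  rewrite !coef_sum; apply: eq_bigr => j _; rewrite !coef_sum.
  pose F k' := (acoef a j k'.+2 * u j i) * (k == k'.+2)%:R.
  rewrite (eq_bigr (fun k' : 'I_alpha.-1 => F k')) => [|k' _]; last first.
    by rewrite coefZ coefXn.
  rewrite [RHS](eq_bigr (fun k' : 'I_s.-1 => F k')) => [|k' _]; last first.
    by rewrite coefZ coefXn.
  have les : (alpha.-1 <= s.-1)%N by rewrite -!subn1 leq_sub2r.
  rewrite (big_ord_widen _ F les) big_mkcond /=; apply: eq_bigr => k' _.
  case: ltnP => // ak'; rewrite /F; case: eqP => [kE|]; last by rewrite mulr0.
  by move: ka; rewrite kE; case: alpha le ak' {les} => //= b _ bk;
    rewrite ltnS ltnNge bk.
have hdiff1 e : hdiff (pol_fun Q I0) [:: e] I0 = T e 0%N.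
  by rewrite -TE // Taylor_coef0 hdiff_pol_fun0.
have TD : forall e e' alpha, T (e + e') alpha = T e alpha + T e' alpha.
  by move=> e e' alpha; rewrite /T dderlD cpolyD coefD.
have TZ : forall c e alpha, T (c *: e) alpha = c * T e alpha.
  by move=> c e alpha; rewrite /T dderlZ cpolyZ coefZ.
have T0 : forall alpha, T 0 alpha = 0.
  by move=> alpha; rewrite /T dderl0 -(mpolyC0 n R) cpolyC coefC; case: eqP.
have Tv alpha : T v alpha = T u1 alpha + \sum_j acoef a j 1 * T (row j u) alpha.
  rewrite vE TD (big_morph (T^~ alpha) (fun x y => TD x y alpha) (T0 alpha)).
  by congr (_ + _); apply: eq_bigr => j _; exact: TZ.
have flatE : flat_along_jet Q (col_mx u1 u : 'M[R]_(p.+1, n)) a <->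
    forall alpha, (alpha <= s)%N ->
      T u1 alpha = 0 /\ forall j, T (row j u) alpha = 0.
  have r0 : row ord0 (col_mx u1 u : 'M[R]_(p.+1, n)) = u1.
    by apply/rowP => i; rewrite mxE col_mx_ord0.
  have rS j : row (lift ord0 j) (col_mx u1 u : 'M[R]_(p.+1, n)) = row j u.
    by apply/rowP => i; rewrite [LHS]mxE col_mx_lift mxE.
  have cE : curve v u a s =
      (fun i => \sum_l (col_mx u1 u : 'M[R]_(p.+1, n)) l i *: jet_poly a l).
    by apply/funext => i; exact: curve_jet_poly.
  rewrite /flat_along_jet -cE; split=> [H alpha le|H l alpha le].
    split=> [|j]; first by have := H ord0 _ le; rewrite r0.
    by have := H (lift ord0 j) _ le; rewrite rS.
  have [H1 Hj] := H _ le; case: (unliftP ord0 l) => [j|] ->.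
    by rewrite rS; exact: Hj.
  by rewrite r0.
have vflat : (forall alpha, (alpha <= s)%N ->
      T u1 alpha = 0 /\ forall j, T (row j u) alpha = 0) <->
    (forall alpha, (alpha <= s)%N ->
      T v alpha = 0 /\ forall j, T (row j u) alpha = 0).
  split=> H alpha le; have [H1 Hj] := H _ le; split=> //.
    by rewrite Tv H1 add0r big1 // => j _; rewrite Hj mulr0.
  by move: H1; rewrite Tv [X in _ + X]big1 ?addr0 // => j _; rewrite Hj mulr0.
have sumE : (\sum_(l < p.+1) \sum_(1 <= alpha < s.+1)
      `|calH (pol_fun Q I0) I0 v u a l alpha| = 0) <->
    (forall l alpha, (1 <= alpha <= s)%N ->
       calH (pol_fun Q I0) I0 v u a l alpha = 0).
  split=> [/eqP|H]; last first.
    rewrite big1 // => l _; rewrite big_nat big1 // => alpha a1s.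
    by rewrite H ?normr0.
  rewrite psumr_eq0 => [/allP H l alpha a1s|l _]; last first.
    by apply: sumr_ge0 => alpha _; exact: normr_ge0.
  have /eqP/eqP := H l (mem_index_enum _).
  rewrite psumr_eq0 => [/allP|i _]; last exact: normr_ge0.
  by move=> /(_ alpha); rewrite mem_index_iota => /(_ a1s) /=;
    rewrite normr_eq0 => /eqP.
rewrite flatE vflat sumE calH_eq0P; split=> [[[Hv Hj] H] alpha le|H].
  rewrite !hdiff1 in Hv; have [->|a0] := posnP alpha.
    by split=> // j; rewrite -hdiff1.
  have [|H1 H2] := H alpha; first by rewrite a0.
  by split=> [|j]; rewrite -TE.
split.
  by rewrite hdiff1; have [H1 H2] := H _ (leq0n s); split=> // j;
    rewrite hdiff1.
move=> alpha /andP[_ le]; have [H1 H2] := H _ le.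
by split=> [|j]; rewrite TE.
Qed.

End GradientAlongJets.

Section VanishingAsFlatness.
Variable R : realType.

Definition jet_of s m (g : 'I_m -> R -> R) (j : 'I_m) : {poly R} :=
  \sum_(k < s.+1) ((g j)^`(k)%classic 0 / k`!%:R) *: 'X^k.

Lemma coef_jet_of s m (g : 'I_m -> R -> R) j k : (k <= s)%N ->
  (jet_of s g j)`_k = (g j)^`(k)%classic 0 / k`!%:R.
Proof.
move=> ks; rewrite coef_sum (bigD1 (Ordinal (ks : (k < s.+1)%N))) //=.
rewrite coefZ coefXn eqxx mulr1 big1 ?addr0 // => i ik.
rewrite coefZ coefXn; case: eqP => [E|]; last by rewrite mulr0.
by case/eqP: ik; exact: val_inj.
Qed.

Lemma size_jet_of s m (g : 'I_m -> R -> R) j : (size (jet_of s g j) <= s.+1)%N.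
Proof.
apply: (leq_trans (size_sum _ _ _)); apply/bigmax_leqP => k _.
by apply: (leq_trans (size_scale_leq _ _)); rewrite size_polyXn.
Qed.

(** By the chain rule the partial derivatives of [Q o A] at [J t] are the
    derivatives of [Q] along the columns of [A] at [A (J t)]; along the
    truncated curve they are polynomials in [t], and the derivative of order
    [alpha] at [0] is [alpha!] times a coefficient. *)
Lemma s_vanishing_pol_comp_mx s m n (Q : mpoly n R) (A : 'M[R]_(n, m)) :
  s_vanishing s (pol_comp_mx Q A) <->
  exists2 g, @Theta R m g & forall l alpha, (alpha <= s)%N ->
    (cpoly (dder (col l A)^T Q) (fun i => \sum_j A i j *: jet_of s g j))`_alpha
      = 0.
Proof.
have E (g : 'I_m -> R -> R) l alpha :
    (fun t => meval (truncation s g t) (mderiv l (pol_comp_mx Q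
      A)))^`(alpha)%classic 0
    = (cpoly (dder (col l A)^T Q)
         (fun i => \sum_j A i j *: jet_of s g j))`_alpha * alpha`!%:R.
  rewrite -derive1n_horner0; congr (_^`(_)%classic 0); apply/funext => t.
  rewrite mderiv_pol_comp_mx meval_pol_comp_mx horner_cpoly.
  apply: meval_eq => i; rewrite horner_sum; apply: eq_bigr => j _.
  rewrite hornerZ; congr (_ * _); rewrite /jet_of horner_sum.
  by apply: eq_bigr => k _; rewrite !hornerE.
split=> -[g Tg H]; exists g => // l alpha le; last by rewrite E H ?mul0r.
by have /eqP := H l _ le; rewrite E mulf_eq0 pnatr_eq0 -leqn0 leqNgt fact_gt0
  orbF => /eqP.
Qed.

(** The jet is itself a curve of the bad set, being polynomial. *)
Lemma flat_s_vanishing p s n (Q : mpoly n R) (U : 'M[R]_(p.+1, n))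
    (a : 'M[R]_(p, s)) : (0 < s)%N ->
  flat_along_jet Q U a -> s_vanishing s (pol_comp_mx Q U^T).
Proof.
move=> s0 flat; apply/s_vanishing_pol_comp_mx.
pose g (l : 'I_p.+1) := horner (jet_poly a l).
have gE l : jet_of s g l = jet_poly a l.
  have size_jet : (size (jet_poly a l) <= s.+1)%N.
    rewrite /jet_poly; case: unlift => [j|]; last by rewrite size_polyX ltnS.
    apply: (leq_trans (size_sum _ _ _)); apply/bigmax_leqP => k _.
    by apply: (leq_trans (size_scale_leq _ _)); rewrite size_polyXn !ltnS.
  apply/polyP => k; have [ks|ks] := leqP k s; last first.
    by rewrite !nth_default // ?(leq_trans size_jet) // (leq_trans (size_jet_of
      _ _ _)).
  by rewrite coef_jet_of // /g derive1n_horner0 mulfK // pnatr_eq0 -lt0n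
    fact_gt0.
exists g => [|l alpha le].
  split=> [j|j|].
  - by near=> t; exact: analytic_at_horner.
  - rewrite /g /jet_poly; case: unlift => [k|]; last by rewrite hornerX.
    rewrite horner_sum big1 // => i _.
    by rewrite hornerZ hornerXn expr0n mulr0.
  - by exists ord0; near=> t; rewrite /g jet_poly0 hornerX.
rewrite -[RHS](flat l _ le); congr (cpoly (dder _ _) _)`_ _.
  by apply/rowP => i; rewrite !mxE.
by apply/funext => i; apply: eq_bigr => j _; rewrite gE mxE.
Unshelve. all: by end_near.
Qed.

(** The columns of [A] are permuted so that the coordinate equal to [t] comes
    first; as [s > 0], the jet of that coordinate is ['X]. *)
Lemma s_vanishing_flat p s n (Q : mpoly n R) (A : 'M[R]_(n, p.+1)) :
  (0 < s)%N -> A^T *m A = 1%:M -> s_vanishing s (pol_comp_mx Q A) ->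
  exists (u1 : 'rV[R]_n) (u : 'M[R]_(p, n)) (a : 'M[R]_(p, s)),
    (col_mx u1 u : 'M[R]_(p.+1, n)) *m (col_mx u1 u : 'M[R]_(p.+1, n))^T = 1%:M
      /\
    flat_along_jet Q (col_mx u1 u : 'M[R]_(p.+1, n)) a.
Proof.
move=> s0 AA /s_vanishing_pol_comp_mx[g [gan g0 [i0 gi0]] H].
(* The permutation of the coordinates that moves [i0] to the first place. *)
pose pi (l : 'I_p.+1) := if unlift ord0 l is Some j then lift i0 j else i0.
have pi0 : pi ord0 = i0 by rewrite /pi unlift_none.
have piS j : pi (lift ord0 j) = lift i0 j by rewrite /pi liftK.
have pi_inj : injective pi.
  move=> l l'; case: (unliftP ord0 l) => [j|] ->;
    case: (unliftP ord0 l') => [j'|] ->;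
  rewrite ?pi0 ?piS => // E.
  - by rewrite (lift_inj E).
  - by have := neq_lift i0 j; rewrite E eqxx.
  - by have := neq_lift i0 j'; rewrite -E eqxx.
pose u1 : 'rV[R]_n := \row_x A x i0.
pose u : 'M[R]_(p, n) := \matrix_(j, x) A x (lift i0 j).
have UE l x : (col_mx u1 u : 'M[R]_(p.+1, n)) l x = A x (pi l).
  case: (unliftP ord0 l) => [j|] ->; first by rewrite col_mx_lift mxE piS.
  by rewrite col_mx_ord0 mxE pi0.
pose a : 'M[R]_(p, s) := \matrix_(j, k) (jet_of s g (lift i0 j))`_k.+1.
exists u1, u, a; split.
  apply/matrixP => l l'; rewrite !mxE.
  have /matrixP/(_ (pi l) (pi l')) := AA; rewrite !mxE (inj_eq pi_inj) => <-.
  by apply: eq_bigr => x _; rewrite [X in _ * X]mxE !UE mxE.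
have jetE l : jet_poly a l = jet_of s g (pi l).
  case: (unliftP ord0 l) => [j|] ->.
    rewrite jet_polyS piS [in RHS]/jet_of big_ord_recl derive1n0 g0 mul0r
      scale0r.
    by rewrite add0r; apply: eq_bigr => k _; rewrite mxE coef_jet_of.
  rewrite jet_poly0 pi0; apply/polyP => k; have [ks|ks] := leqP k s; last first.
    rewrite [RHS]nth_default ?(leq_trans (size_jet_of _ _ _)) // coefX.
    by case: eqP => // k1; move: ks; rewrite k1 ltnS leqNgt s0.
  rewrite coef_jet_of // (@near_eq_derive1n _ _ (horner 'X)).
    by rewrite derive1n_horner0 mulfK // pnatr_eq0 -lt0n fact_gt0.
  by apply: filterS gi0 => t ->; rewrite hornerX.
move=> l alpha le; rewrite -[RHS](H (pi l) _ le);
  congr (cpoly (dder _ _) _)`_ _.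
  by apply/rowP => x; rewrite [LHS]mxE UE !mxE.
apply/funext => x; rewrite [RHS](bigD1_ord i0) //= big_ord_recl; congr (_ + _).
  by rewrite UE jetE pi0.
by apply: eq_bigr => j _; rewrite UE jetE piS.
Qed.

(** The change of basis from [(u_1, u_2, .., u_m)] to [(v, u_2, .., u_m)] is
    unipotent, hence it preserves the rank. *)
Lemma rank_col_mx_shift p n (u1 v : 'rV[R]_n) (u : 'M[R]_(p, n)) (b : 'rV[R]_p)
  :
  (col_mx u1 u) *m (col_mx u1 u)^T = 1%:M ->
  v = u1 + \sum_(j < p) b 0 j *: row j u -> \rank (col_mx v u) = p.+1.
Proof.
move=> UU vE.
have -> : col_mx v u = block_mx 1%:M b 0 1%:M *m col_mx u1 u.
  rewrite mul_block_col !mul1mx mul0mx add0r vE; congr (col_mx (_ + _) _).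
  apply/rowP => i; rewrite !mxE summxE; apply: eq_bigr => j _.
  by rewrite !mxE.
rewrite mxrankMfree; last by apply/row_freeP; exists (col_mx u1 u)^T.
apply/eqP; rewrite -[_ == _]/(row_free _) row_free_unit unitmxE.
by rewrite det_ublock !det1 mulr1 unitr1.
Qed.

End VanishingAsFlatness.

Section Projection.
Variables (R : realType) (r n : nat) (I0 : 'rV[R]_n).

(** For [m = 1] the curve is [t w], and the Taylor coefficient of the derivative
    along [w] is, up to [alpha!], a single differential of [Q]. *)
Lemma Taylor_coef_line s (Q : mpoly n R) (w : 'rV[R]_n) (u : 'M[R]_(0, n))
    (a : 'M[R]_(0, s)) alpha :
  Taylor_coef Q w u a w alpha =
  (alpha`!%:R)^-1 * hdiff (pol_fun Q I0) (nseq alpha.+1 w) I0.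
Proof.
case: (posnP alpha) => [->|alpha0].
  by rewrite Taylor_coef0 invr1 mul1r hdiff_pol_fun0.
rewrite Taylor_coefE (sum_kap_ord0 alpha0 (@Taylor_term _ _ _ _ Q w u a w
  alpha)).
rewrite [X in _ + X + _]big_ord0 addr0 big1 ?addr0 => [|kap /andP[/eqP wt]].
  rewrite -[alpha.+1]addn1 nseqD hdiff_rcons /Taylor_term au_const0 cats0.
  by rewrite kfact_const0 muln1 mulrC.
by rewrite exceptional_ord0 // big_ord0.
Qed.

Lemma Z1_eqs_flatP s (Q : mpoly n R) (w : 'rV[R]_n) (u : 'M[R]_(0, n))
    (a : 'M[R]_(0, s)) : (0 < s)%N ->
  (forall k, (1 <= k <= s.+1)%N -> hdiff (pol_fun Q I0) (nseq k w) I0 = 0) <->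
  flat_along_jet Q (col_mx w u : 'M[R]_(1, n)) a.
Proof.
move=> s0; have E l alpha : (cpoly (dder (row l (col_mx w u : 'M[R]_(1, n))) Q)
    (fun i => \sum_l' (col_mx w u : 'M[R]_(1, n)) l' i *: jet_poly a
      l'))`_alpha =
    (alpha`!%:R)^-1 * hdiff (pol_fun Q I0) (nseq alpha.+1 w) I0.
  rewrite -(Taylor_coef_line Q w u a) /Taylor_coef.
  have -> : row l (col_mx w u : 'M[R]_(1, n)) = w.
    by apply/rowP => i; rewrite mxE ord1 col_mx_ord0.
  congr (cpoly _ _)`_ _; apply/funext => i;
    rewrite -(@curve_jet_poly _ _ _ _ _ _ _ w) //.
    by rewrite /curve !big_ord0.
  by rewrite big_ord0 addr0.
split=> [H l alpha le|H [//|k] ks]; first by rewrite E H ?mulr0.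
have /eqP := H ord0 k ks.
by rewrite E mulf_eq0 invr_eq0 pnatr_eq0 -leqn0 leqNgt fact_gt0 => /eqP.
Qed.

Lemma norm2_eq1 (w : 'rV[R]_n) : norm2 w = 1 <-> w *m w^T = 1%:M.
Proof.
have E : (w *m w^T) 0 0 = \sum_i w 0 i ^+ 2.
  by rewrite mxE; apply: eq_bigr => i _; rewrite mxE.
have ge0 : 0 <= \sum_i w 0 i ^+ 2 by apply: sumr_ge0 => i _; exact: sqr_ge0.
split=> [H|H].
  apply/matrixP => i j; rewrite !ord1 E [RHS]mxE eqxx.
  by rewrite -[LHS]sqr_sqrtr // -/(norm2 w) H expr1n.
by rewrite /norm2 -E H mxE eqxx sqrtr1.
Qed.

Lemma Stiefel_col_mx p (u1 : 'rV[R]_n) (u : 'M[R]_(p, n)) :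
  Stiefel (col_mx u1 u) -> Stiefel u1 /\ Stiefel u.
Proof.
rewrite /Stiefel /= tr_col_mx mul_col_row -[1%:M in X in X -> _]/(1%:M).
rewrite scalar_mx_block => /eq_block_mx[-> _ _ ->] //.
Qed.

Lemma projZE p s : (0 < s)%N ->
  projZ r I0 p s =
  [set Q | Polstar r Q /\ exists A : 'M[R]_(n, p.+1),
     A^T *m A = 1%:M /\ s_vanishing s (pol_comp_mx Q A)].
Proof.
move=> s0; apply/seteqP; split=> [Q|Q [PQ [A [AA /(s_vanishing_flat s0 AA)]]]].
  case: p => [[[Q' w] /= [PQ nw H] <-]|p [[[Q' a] [v u]] /=]].
    split=> //; pose u : 'M[R]_(0, n) := 0; pose a : 'M[R]_(0, s) := 0.
    exists (col_mx w u : 'M[R]_(1, n))^T; split; last first.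
      by apply: (@flat_s_vanishing _ _ _ _ _ _ a) => //; exact/Z1_eqs_flatP.
    rewrite trmxK; apply/matrixP => i j; rewrite !ord1.
    move/norm2_eq1/matrixP: nw => <-; rewrite !mxE; apply: eq_bigr => x _.
    by rewrite [X in _ * X]mxE !col_mx_ord0 mxE.
  move=> [PQ Vvu [u1 [U vE]] H1 H2] <-; split=> //.
  exists (col_mx u1 u : 'M[R]_(p.+2, n))^T; rewrite trmxK; split => //.
  by apply: (@flat_s_vanishing _ _ _ _ _ _ a) => //;
    apply/(Zm_eqs_flatP _ I0 s0 vE).
move=> [u1 [u [a [U flat]]]].
case: p A AA u a U flat => [|p] A AA u a U flat.
  have [SU _] := Stiefel_col_mx U.
  exists (Q, u1) => //; split=> //=; first exact/norm2_eq1.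
  exact/(Z1_eqs_flatP Q u1 u a s0).
pose v := u1 + \sum_(j < p.+1) acoef a j 1 *: row j u.
have [HH H] := (Zm_eqs_flatP Q I0 s0 (erefl v)).2 flat.
exists (Q, a, (v, u)) => //; split=> //.
- split; first by have [] := Stiefel_col_mx U.
  apply: (rank_col_mx_shift (b := \row_j acoef a j 1) U).
  by rewrite /v; congr (_ + _); apply: eq_bigr => j _; rewrite mxE.
- by exists u1.
Qed.

End Projection.

(** * Closures *)

Section Degrees.
Variable R : realType.

(** Membership in [Pol] is a set of linear conditions on the coefficients. *)
Lemma PolP r n (P : mpoly n R) : Pol r P <->
  (forall b, mdeg b = 0%N \/ (r < mdeg b)%N -> mcoeff b P = 0).
Proof.
split=> [[P0 Pr] b [/eqP|rb]|H].
- by rewrite mdeg_eq0 => /eqP ->.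
- by apply/eqP; rewrite mcoeff_eq0 msize_mdeg_ge // (leq_trans Pr).
- split; first by apply: H; left; rewrite mdeg0.
  rewrite mmeasureE; apply/bigmax_leqP_seq => b bP _; rewrite ltnS leqNgt.
  by apply/negP => rb; move: bP; rewrite mcoeff_msupp H ?eqxx //; right.
Qed.

Lemma Pol_linear r n c (P Q : mpoly n R) : Pol r P -> Pol r Q -> Pol r (c *: P
  + Q).
Proof.
move=> /PolP HP /PolP HQ; apply/PolP => b hb.
by rewrite mcoeffD mcoeffZ HP // HQ // mulr0 addr0.
Qed.

(** A monomial becomes a product of as many linear forms as its degree. *)
Lemma msize_pol_comp_mxX m n (A : 'M[R]_(n, m)) (b : multinom n) :
  (mmeasure mdeg (pol_comp_mx (mpolyX R b) A) <= (mdeg b).+1)%N.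
Proof.
pose small d (P : mpoly m R) := (mmeasure mdeg P <= d.+1)%N.
have small1 : small 0 1 by rewrite /small msize1.
have smallM d e P Q : small d P -> small e Q -> small (d + e)%N (P * Q).
  rewrite /small => hP hQ; have [->|P0] := eqVneq P 0.
    by rewrite mul0r mmeasure0.
  have [->|Q0] := eqVneq Q 0; first by rewrite mulr0 mmeasure0.
  by rewrite msizeM // -subn1 leq_subLR add1n -addSn -addnS leq_add.
rewrite /pol_comp_mx comp_mpolyX mdegE -[(_ <= _)%N]/(small _ _).
apply: (big_rec2 (fun P d => small d P)) => // i P d _ hd;
  apply: (smallM) => //.
rewrite tnth_mktuple; elim: (b i) => [|k IH]; first by rewrite expr0.
rewrite exprS -add1n; apply: (smallM) => //; rewrite /small.
apply: (leq_trans (msize_sum _ _ _)); apply/bigmax_leqP => j _.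
by apply: (leq_trans (msizeZ_le _ _)); rewrite msizeX mdeg1.
Qed.

Lemma Pol_pol_comp_mx r m n (A : 'M[R]_(n, m)) (Q : mpoly n R) :
  Pol r Q -> Pol r (pol_comp_mx Q A).
Proof.
move=> [Q0 Qr]; split; first by rewrite mcoeff0_pol_comp_mx.
rewrite [Q in pol_comp_mx Q](mpolyE Q) pol_comp_mx_sum.
apply: (leq_trans (msize_sum _ _ _)); apply/bigmax_leqP_seq => b bQ _.
rewrite pol_comp_mxZ; apply: (leq_trans (msizeZ_le _ _)).
apply: (leq_trans (msize_pol_comp_mxX _ _)).
exact: leq_trans (msize_mdeg_lt bQ) Qr.
Qed.

Lemma meval0_mderiv n (Q : mpoly n R) i :
  meval (fun=> 0) (mderiv i Q) = mcoeff (mnm1 i) Q.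
Proof. by rewrite meval0E mcoeff_deriv add0m mnm0E. Qed.

Definition pol_of r n (q : 'rV[R]_#|monomials r n|) : mpoly n R :=
  \sum_i q 0 i *: mpolyX R (enum_val i : bmultinom n r.+1).

Lemma coefvK r n (P : mpoly n R) : Pol r P -> pol_of (coefv r P) = P.
Proof.
move=> PP; have /PolP HP := PP; apply/mpolyP => b.
rewrite /pol_of raddf_sum.
have [/andP[b0 br]|bN] := boolP ((0 < mdeg b) && (mdeg b <= r))%N; last first.
  have bNE : mdeg b = 0%N \/ (r < mdeg b)%N.
    by move: bN; rewrite negb_and -leqNgt leqn0 -ltnNge => /orP[/eqP|];
      [left|right].
  rewrite HP // big1 // => i _; rewrite /= mcoeffZ mxE mcoeffX.
  have [E|] := eqVneq; last by rewrite mulr0.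
  by rewrite E HP // mul0r.
pose bb := BMultinom (br : (mdeg b < r.+1)%N).
have bbm : bb \in monomials r n by rewrite inE.
rewrite (bigD1 (enum_rank_in bbm bb)) //= mcoeffZ mxE mcoeffX enum_rankK_in //.
rewrite eqxx mulr1 big1 ?addr0 // => i ib; rewrite mcoeffZ mcoeffX.
have [E|] := eqVneq; last by rewrite mulr0.
case/eqP: ib; apply: enum_val_inj; rewrite enum_rankK_in //; exact: val_inj.
Qed.

End Degrees.

Section ContinuousCoefficients.
Variables (R : realType) (T : topologicalType).

(** The topology on polynomials of bounded degree is that of the coefficients.
    *)
Definition coef_continuous n (f : T -> mpoly n R) :=
  forall b, continuous (fun x => mcoeff b (f x)).

Lemma continuous_big_sum (I : Type) (r : seq I) (P : pred I) (F : I -> T -> R) :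
  (forall i, continuous (F i)) -> continuous (fun x => \sum_(i <- r | P i) F i
    x).
Proof.
move=> cF; elim: r => [|i r IH].
  rewrite (_ : (fun x => _) = cst 0); first exact: cst_continuous.
  by apply/funext => x; rewrite big_nil.
rewrite (_ : (fun x => _) = fun x =>
    (if P i then F i x else 0) + \sum_(j <- r | P j) F j x); last first.
  by apply/funext => x; rewrite big_cons; case: ifP; rewrite ?add0r.
move=> x; apply: cvgD; last exact: IH.
by case: (P i); [exact: cF|exact: cvg_cst].
Qed.

Lemma continuous_fctM (f g : T -> R) :
  continuous f -> continuous g -> continuous (fun x => f x * g x).
Proof. by move=> cf cg x; apply: cvgM; [exact: cf|exact: cg]. Qed.

Lemma coef_continuous_cst n (P : mpoly n R) : coef_continuous (fun=> P).
Proof. by move=> b x; exact: cvg_cst. Qed.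

Lemma coef_continuousD n (f g : T -> mpoly n R) :
  coef_continuous f -> coef_continuous g -> coef_continuous (fun x => f x + g
    x).
Proof.
move=> cf cg b x; under eq_fun do rewrite mcoeffD.
by apply: cvgD; [exact: cf|exact: cg].
Qed.

Lemma coef_continuousZ n (c : T -> R) (f : T -> mpoly n R) :
  continuous c -> coef_continuous f -> coef_continuous (fun x => c x *: f x).
Proof.
move=> cc cf b x; under eq_fun do rewrite mcoeffZ.
by apply: cvgM; [exact: cc|exact: cf].
Qed.

Lemma coef_continuous_sum n (I : Type) (r : seq I) (F : I -> T -> mpoly n R) :
  (forall i, coef_continuous (F i)) ->
  coef_continuous (fun x => \sum_(i <- r) F i x).
Proof.
move=> cF b x; under eq_fun do rewrite raddf_sum.
by apply: continuous_big_sum => i; exact: cF.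
Qed.

Lemma coef_continuousM n (f g : T -> mpoly n R) :
  coef_continuous f -> coef_continuous g -> coef_continuous (fun x => f x * g
    x).
Proof.
move=> cf cg b x; under eq_fun do rewrite mcoeffM.
apply: continuous_big_sum => k y.
by apply: cvgM; [exact: cf|exact: cg].
Qed.

Lemma coef_continuous_prod n (I : Type) (r : seq I) (F : I -> T -> mpoly n R) :
  (forall i, coef_continuous (F i)) ->
  coef_continuous (fun x => \prod_(i <- r) F i x).
Proof.
move=> cF; elim: r => [|i r IH].
  rewrite (_ : (fun x => _) = fun=> 1); first exact: coef_continuous_cst.
  by apply/funext => x; rewrite big_nil.
rewrite (_ : (fun x => _) = fun x => F i x * \prod_(j <- r) F j x).
  exact: coef_continuousM.
by apply/funext => x; rewrite big_cons.
Qed.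

Lemma coef_continuousX n (f : T -> mpoly n R) k :
  coef_continuous f -> coef_continuous (fun x => f x ^+ k).
Proof.
move=> cf; rewrite (_ : (fun x => _) = fun x => \prod_(i < k) f x).
  exact: coef_continuous_prod.
by apply/funext => x; rewrite prodr_const card_ord.
Qed.

Lemma coef_continuous_pol_comp_mx r m n (q : T -> 'rV[R]_#|monomials r n|)
    (A : T -> 'M[R]_(n, m)) :
  (forall i, continuous (fun x => q x 0 i)) ->
  (forall i j, continuous (fun x => A x i j)) ->
  coef_continuous (fun x => pol_comp_mx (pol_of (q x)) (A x)).
Proof.
move=> cq cA; rewrite (_ : (fun x => _) = fun x => \sum_i q x 0 i *:
    \prod_(k < n) (\sum_(j < m) A x k j *: mpolyX R (mnm1 j)) ^+
      (enum_val i : bmultinom n r.+1) k).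
  apply: coef_continuous_sum => i; apply: coef_continuousZ => //.
  apply: coef_continuous_prod => k; apply: coef_continuousX.
  apply: coef_continuous_sum => j; apply: coef_continuousZ => //.
  exact: coef_continuous_cst.
apply/funext => x; rewrite /pol_of pol_comp_mx_sum; apply: eq_bigr => i _.
rewrite pol_comp_mxZ /pol_comp_mx comp_mpolyX; congr (_ *: _).
by apply: eq_bigr => k _; rewrite tnth_mktuple.
Qed.

Lemma continuous_rV d (f : T -> 'rV[R]_d) :
  (forall i, continuous (fun x => f x 0 i)) -> continuous f.
Proof.
move=> cf x; apply/cvg_ballP => e e0.
have : \forall y \near x, forall i, ball (f x 0 i) e (f y 0 i).
  by apply: filter_forall => i; have /cvg_ballP/(_ _ e0) := cf i x.
by apply: filterS => y H; split=> // i j; rewrite ord1.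
Qed.

Lemma continuous_coefv r n (f : T -> mpoly n R) :
  coef_continuous f -> continuous (fun x => coefv r (f x)).
Proof.
move=> cf; apply: continuous_rV => i.
rewrite (_ : (fun x => _) = fun x => mcoeff (enum_val i : bmultinom n r.+1) (f
  x)).
  exact: cf.
by apply/funext => x; rewrite mxE.
Qed.

End ContinuousCoefficients.

Section OrthonormalFrames.
Variables (R : realType) (m n : nat).

(** Frames are parametrised by row vectors, for which closed bounded sets are
    compact. *)
Definition frames : set 'rV[R]_(n * m) :=
  [set x | (vec_mx x)^T *m vec_mx x = 1%:M].

Lemma continuous_vec_mx i j :
  continuous (fun x : 'rV[R]_(n * m) => (vec_mx x : 'M[R]_(n, m)) i j).
Proof.
rewrite (_ : (fun x => _) = fun x : 'rV[R]_(n * m) => x 0 (mxvec_index i j)).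
  exact: coord_continuous.
by apply/funext => x; rewrite mxE.
Qed.

Lemma closed_frames : closed frames.
Proof.
pose f i j (x : 'rV[R]_(n * m)) : R := ((vec_mx x)^T *m (vec_mx x : 'M[R]_(n,
  m))) i j.
rewrite (_ : frames = \bigcap_(ij in [set: 'I_m * 'I_m])
    (f ij.1 ij.2 @^-1` [set (ij.1 == ij.2)%:R])); last first.
  apply/seteqP; split=> [x xF [i j] _|x xF] /=; first by rewrite /f xF mxE.
  by apply/matrixP => i j; have := xF (i, j) Logic.I; rewrite /= /f => ->;
    rewrite mxE.
apply: closed_bigI => -[i j] _ /=.
apply: (iffLR (continuous_closedP _)); last exact: closed_eq.
rewrite /f (_ : (fun x => _) = fun x : 'rV[R]_(n * m) => \sum_k
    (vec_mx x : 'M[R]_(n, m)) k i * (vec_mx x : 'M[R]_(n, m)) k j); last first.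
  by apply/funext => y; rewrite mxE; apply: eq_bigr => k _; rewrite mxE.
apply: continuous_big_sum => k.
by apply: continuous_fctM; exact: continuous_vec_mx.
Qed.

Lemma compact_frames : compact frames.
Proof.
have cube : compact [set x : 'rV[R]_(n * m) |
    forall i, `[(-1 : R), 1]%classic (x ord0 i)].
  by apply: (@rV_compact _ _ (fun=> `[(-1 : R), 1]%classic)) => i;
    exact: segment_compact.
apply: (subclosed_compact closed_frames cube) => x xF c /=.
case/mxvec_indexP: c => i j.
have /matrixP/(_ j j) := xF; rewrite !mxE eqxx => sum1.
rewrite in_itv /= -ler_norml -[leRHS]sqrtr1 -sqrtr_sqr ler_wsqrtr //
  -[leRHS]sum1.
rewrite (bigD1 i) //= !mxE -expr2 lerDl; apply: sumr_ge0 => k _.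
by rewrite !mxE -expr2 sqr_ge0.
Qed.

End OrthonormalFrames.

Section Closures.
Variables (R : realType) (r n p s : nat) (I0 : 'rV[R]_n).
Hypothesis s_gt0 : (0 < s)%N.

(** If no frame [A] works for [Q], then each [A] has a neighbourhood which,
    together with a neighbourhood of [Q], avoids the closed set of polynomials
    that are limits of [s]-vanishing ones. By compactness of the set of frames
    one neighbourhood of [Q] serves for all [A], and it cannot meet the
    projection. *)
Lemma closure_projZ_sub :
  closure_in r (@Polstar R r n) (projZ r I0 p s) `<=` @badV R r s p.+1 n.
Proof.
move=> Q [PQ clQ]; split=> //; apply: contrapT => noA.
pose C := closure (@coefv R r p.+1 @` @sigma R r s p.+1).
pose Phi (z : 'rV[R]_(n * p.+1) * 'rV[R]_#|monomials r n|) :=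
  coefv r (pol_comp_mx (pol_of z.2) (vec_mx z.1 : 'M[R]_(n, p.+1))).
have cPhi : continuous Phi.
  apply: continuous_coefv; apply: coef_continuous_pol_comp_mx => [i|i j] z.
    apply: (@continuous_comp _ _ _ snd (fun q : 'rV[R]_#|monomials r n| => q 0
      i)).
      exact: cvg_snd.
    exact: coord_continuous.
  apply: (@continuous_comp _ _ _ fst (fun x : 'rV[R]_(n * p.+1) => (vec_mx x :
    'M[R]_(n, p.+1)) i j)).
    exact: cvg_fst.
  exact: continuous_vec_mx.
have /compact_near_coveringP cover := @compact_frames R p.+1 n.
have near_out : \forall q \near coefv r Q, @frames R p.+1 n `<=` (fun x => ~ C
  (Phi (x, q))).
  apply: (cover _ (nbhs (coefv r Q)) (fun q x => ~ C (Phi (x, q)))) => x xF.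
  have out : ~ C (Phi (x, coefv r Q)).
    rewrite /Phi /= coefvK; last by case: PQ.
    move=> CQ; apply: noA; exists (vec_mx x); split => //; split => //.
    by apply: Pol_pol_comp_mx; case: PQ.
  have oC : open (~` C) by apply: closed_openC; exact: closed_closure.
  exact: (cPhi (x, coefv r Q) _ (open_nbhs_nbhs (conj oC out))).
have [_ [[Q' ZQ' <-] out]] := clQ _ near_out.
move: ZQ'; rewrite projZE // => -[PQ' [A [AA sA]]].
have PolQ' : Pol r Q' by case: PQ'.
apply: (out (mxvec A)); first by rewrite /frames /= mxvecK.
apply: subset_closure; exists (pol_comp_mx Q' A).
  by split => //; exact: Pol_pol_comp_mx.
by rewrite /Phi /= mxvecK coefvK.
Qed.

(** Moving [Q o A] to a nearby [s]-vanishing [P] is achieved by the small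
    correction [(P - Q o A) o A^T] of [Q]; the gradient at the origin stays
    non-zero because it is a continuous function of the coefficients. *)
Lemma badV_sub_closure_projZ :
  @badV R r s p.+1 n `<=` closure_in r (@Polstar R r n) (projZ r I0 p s).
Proof.
move=> Q [PQ [A [AA [PQA clQA]]]]; split => // B nB.
have PolQ : Pol r Q by case: PQ.
pose corr (P : mpoly p.+1 R) := Q + pol_comp_mx (P - pol_comp_mx Q A) A^T.
have corrQA : corr (pol_comp_mx Q A) = Q.
  by rewrite /corr subrr pol_comp_mx0 addr0.
have corr_cont : coef_continuous (fun q : 'rV[R]_#|monomials r p.+1| => corr
  (pol_of q)).
  rewrite (_ : (fun q => _) = fun q : 'rV[R]_#|monomials r p.+1| =>
    (Q - pol_comp_mx (pol_comp_mx Q A) A^T) + pol_comp_mx (pol_of q) A^T).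
    apply: coef_continuousD; first exact: coef_continuous_cst.
    apply: coef_continuous_pol_comp_mx => [i|i j];
      first exact: coord_continuous.
    exact: cst_continuous.
  by apply/funext => q; rewrite /corr pol_comp_mxB addrAC addrA.
have [i0 grad0] := PQ.2; rewrite meval0_mderiv in grad0.
have nearB : \forall q \near coefv r (pol_comp_mx Q A), B (coefv r (corr
  (pol_of q))).
  apply: (continuous_coefv corr_cont); rewrite coefvK //.
  by rewrite corrQA.
have near0 : \forall q \near coefv r (pol_comp_mx Q A),
    mcoeff (mnm1 i0) (corr (pol_of q)) != 0.
  apply: (corr_cont (mnm1 i0) (coefv r (pol_comp_mx Q A)) [set c : R | c != 0]).
  rewrite coefvK // corrQA.
  exact: (open_nbhs_nbhs (conj (@open_neq _ 0) grad0)).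
have [_ [[P [PP sP] <-] [/= BP grad]]] := clQA _ (filterI nearB near0).
rewrite coefvK // in BP grad.
exists (coefv r (corr P)); split=> //; exists (corr P) => //.
rewrite projZE //; split.
  split; last by exists i0; rewrite meval0_mderiv.
  rewrite /corr addrC -[X in X + _]scale1r; apply: Pol_linear => //.
  by apply: Pol_pol_comp_mx; rewrite addrC -scaleN1r; exact: Pol_linear.
exists A; split => //.
by rewrite /corr pol_comp_mxD pol_comp_mx_mul AA pol_comp_mx1 addrC subrK.
Qed.

End Closures.

(* m = i.+1 ranges over {1, .., n - 1}, and s i is s_m. *)
Theorem corollaryB2 (R : realType) (r n : nat) (s : 'I_n.-1 -> nat)
    (I0 : 'rV[R]_n) :
  (2 <= r)%N -> (2 <= n)%N ->
  (forall i : 'I_n.-1, (1 <= s i <= r.-1)%N) ->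
  \bigcup_(i in [set: 'I_n.-1])
      closure_in r (@Polstar R r n) (projZ r I0 i (s i))
  = @Omega R r n s.
Proof.
move=> _ _ s_bounds; apply: eq_bigcupr => i _.
have s_gt0 : (0 < s i)%N by case/andP: (s_bounds i).
apply/seteqP; split; first exact: closure_projZ_sub.
exact: badV_sub_closure_projZ.
Qed.
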